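(* Let $(X,d_X)$ be a complete $\mathbb{R}$-tree with length $\leq\frac{5\pi}{4}$ and such that $d_{\mathrm{GH}}(X,\mathbb{S}^1)=\frac{\pi}{4}$. Then $(X,d_X)$ is isometric to $\mathrm{E}$.
   Context: $\mathbb{S}^1=\{z\in\mathbb{R}^2 : \|z\|=1\}$ is equipped with its intrinsic (geodesic) metric $d_{\mathbb{S}^1}$, i.e. $d_{\mathbb{S}^1}(p,q)\in[0,\pi]$ is the angle between $p$ and $q$ seen as vectors of $\mathbb{R}^2$. For a metric space $(Z,d_Z)$ and nonempty $A,B\subseteq Z$, let $d_Z(z,A)=\inf_{a\in A}d_Z(z,a)$ and let the Hausdorff distance be $d_{\mathrm{H}}^Z(A,B)=\max\left(\sup_{a\in A}d_Z(a,B),\sup_{b\in B}d_Z(b,A)\right)$. The Gromov-Hausdorff distance between nonempty metric spaces $X,Y$ is the value in $[0,\infty]$ given by $d_{\mathrm{GH}}(X,Y)=\inf d_{\mathrm{H}}^Z(X',Y')$, the infimum being over all metric spaces $Z$ and subspaces $X',Y'\subseteq Z$ with $X'$ isometric to $X$ and $Y'$ isometric to $Y$. An arc in a metric space $X$ is a subspace of $X$ homeomorphic to the interval $[0,1]$. A (nonempty) metric space $(X,d_X)$ is an $\mathbb{R}$-tree if for every two distinct points $x,x'\in X$ there is a unique arc with endpoints $x,x'$, and this arc is a geodesic segment (i.e. isometric to an interval of $\mathbb{R}$). The length of an $\mathbb{R}$-tree $X$ is the supremum of all sums of lengths of pairwise disjoint arcs contained in $X$. $\mathrm{E}$ is the compact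 metric tree (metric graph with its path-length metric) with five edges of length $\frac{\pi}{4}$ described as follows: take three segments of lengths $\frac{\pi}{2},\frac{\pi}{2},\frac{\pi}{4}$ and glue them together at one common endpoint. Equivalently, $\mathrm{E}$ is obtained from a segment of length $\pi$ by attaching to its midpoint one end of a segment of length $\frac{\pi}{4}$. *)

(* Defs.v *)
From HB Require Import structures.
From mathcomp Require Import all_boot all_order all_algebra.
From mathcomp Require Import ring lra.
From mathcomp Require Import all_classical all_reals all_analysis.

Set Implicit Arguments.
Unset Strict Implicit.
Unset Printing Implicit Defensive.

Import Order.TTheory GRing.Theory Num.Theory.
Import numFieldNormedType.Exports.

Local Open Scope classical_set_scope.
Local Open Scope ring_scope.

(* A metricType need not be pointed, whereas the library's completeType is
   pointed; this is the axiom of completeType without a base point. *)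
Definition complete_space {R : realType} (X : metricType R) : Prop :=
  forall F : set_system X, ProperFilter F -> cauchy F -> exists x : X, F --> x.

(* The subspaces A and B are isometric. Only the values of f on A matter; whole
   spaces are compared by taking A and B to be full sets. *)
Definition isometric {R : realType} {X Y : metricType R}
    (A : set X) (B : set Y) : Prop :=
  exists2 f : X -> Y,
    {in A &, forall x y, mdist (f x) (f y) = mdist x y} & f @` A = B.

Definition dist_to_set {R : realType} {Z : metricType R}
    (z : Z) (A : set Z) : \bar R :=
  ereal_inf [set (mdist z a)%:E | a in A].

Definition hausdorff_dist {R : realType} {Z : metricType R}
    (A B : set Z) : \bar R :=
  Order.max (ereal_sup [set dist_to_set a B | a in A])
            (ereal_sup [set dist_to_set b A | b in B]).

Definition GH_dist {R : realType} (X Y : metricType R) : \bar R :=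
  ereal_inf [set e | exists (Z : metricType R) (X' Y' : set Z),
    [/\ isometric X' [set: X], isometric Y' [set: Y]
      & e = hausdorff_dist X' Y']].

Definition homeomorphism {X Y : topologicalType} (A : set X) (B : set Y)
    (f : X -> Y) : Prop :=
  [/\ set_bij A B f, {within A, continuous f} &
      exists2 g : Y -> X, {within B, continuous g} & {in A, cancel f g}].

Definition arc_param {R : realType} {X : metricType R} (A : set X)
    (g : R -> X) : Prop :=
  homeomorphism (`[0, 1] : set R) A g.

Definition is_arc {R : realType} {X : metricType R} (A : set X) : Prop :=
  exists g : R -> X, arc_param A g.

Definition arc_between {R : realType} {X : metricType R} (x y : X)
    (A : set X) : Prop :=
  exists g : R -> X, [/\ arc_param A g, g 0 = x & g 1 = y].

Definition geodesic_segment {R : realType} {X : metricType R}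
    (A : set X) : Prop :=
  exists I : interval R, isometric A ([set` I] : set R^o).

Definition Rtree {R : realType} (X : metricType R) : Prop :=
  [set: X] !=set0 /\
  forall x y : X, x <> y ->
    exists A : set X, [/\ arc_between x y A,
      forall B : set X, arc_between x y B -> B = A & geodesic_segment A].

(* Length of the polygon inscribed in g at the subdivision 0 :: s of [0, 1]
   (compare [variation] for real-valued functions). *)
Definition inscribed_length {R : realType} {X : metricType R} (g : R -> X)
    (s : seq R) : R :=
  let t := nth 1 (0 :: s) in
  \sum_(0 <= i < size s) mdist (g (t i)) (g (t i.+1)).

(* The length of an arc as a curve: the supremum of its inscribed polygons. It
   does not depend on the parametrization g of A, so that taking the supremum
   over all g as well only avoids choosing one. *)
Definition arc_length {R : realType} {X : metricType R} (A : set X) : \bar R :=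
  ereal_sup [set e | exists (g : R -> X) (s : seq R),
    [/\ arc_param A g, itv_partition 0 1 s & e = (inscribed_length g s)%:E]].

Definition tree_length {R : realType} (X : metricType R) : \bar R :=
  ereal_sup [set \esum_(A in F) arc_length A | F in
    [set F : set (set X) | (forall A, F A -> is_arc A) /\ trivIset F id]].

Definition circle (R : realType) : Type :=
  {z : R * R | Num.sqrt (z.1 ^+ 2 + z.2 ^+ 2) == 1}.

Section circle_metric.
Context {R : realType}.
Implicit Types p q : circle R.

HB.instance Definition _ :=
  Choice.copy (circle R) {z : R * R | Num.sqrt (z.1 ^+ 2 + z.2 ^+ 2) == 1}.

Definition circle_dot p q : R :=
  (val p).1 * (val q).1 + (val p).2 * (val q).2.

(* The angle between the unit vectors p and q. *)
Definition circle_dist p q : R := acos (circle_dot p q).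

Lemma circle_sqr p : (val p).1 ^+ 2 + (val p).2 ^+ 2 = 1.
Proof.
have h0 : 0 <= (val p).1 ^+ 2 + (val p).2 ^+ 2 by rewrite addr_ge0 ?sqr_ge0.
by rewrite -[LHS]sqr_sqrtr// (eqP (valP p)) expr1n.
Qed.

Lemma circle_dot_bound p q : -1 <= circle_dot p q <= 1.
Proof.
have := circle_sqr p; have := circle_sqr q; rewrite /circle_dot.
move: (val p) (val q) => [a b] [c d] /= h1 h2.
have := sqr_ge0 (a - c); have := sqr_ge0 (b - d).
have := sqr_ge0 (a + c); have := sqr_ge0 (b + d).
by move=> *; apply/andP; split; nra.
Qed.

Lemma circle_distxx p : circle_dist p p = 0.
Proof.
rewrite /circle_dist (_ : circle_dot p p = 1) ?acos1//.
by rewrite /circle_dot -!expr2 circle_sqr.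
Qed.

Lemma circle_dist_positivity p q : circle_dist p q = 0 -> p = q.
Proof.
rewrite /circle_dist => h.
have : circle_dot p q = 1 by rewrite -[LHS]acosK ?h ?cos0// in_itv/= circle_dot_bound.
have := circle_sqr p; have := circle_sqr q; rewrite /circle_dot => h1 h2 h3.
apply: val_inj; move: (val p) (val q) h1 h2 h3 => [a b] [c d] /= h1 h2 h3.
have : (a - c) ^+ 2 + (b - d) ^+ 2 = 0 by nra.
move/eqP; rewrite paddr_eq0 ?sqr_ge0// !sqrf_eq0 !subr_eq0.
by case/andP => /eqP -> /eqP ->.
Qed.

Lemma circle_dist_sym p q : circle_dist p q = circle_dist q p.
Proof. by rewrite /circle_dist /circle_dot mulrC [X in _ + X]mulrC. Qed.

Lemma circle_dist_triangle q p r :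
  circle_dist p r <= circle_dist p q + circle_dist q r.
Proof.
have bpq := circle_dot_bound p q; have bqr := circle_dot_bound q r.
have bpr := circle_dot_bound p r.
rewrite /circle_dist.
have a0 := acos_ge0 bpq; have b0 := acos_ge0 bqr.
have [hpi|hpi] := leP pi (acos (circle_dot p q) + acos (circle_dot q r)).
  by rewrite (le_trans (acos_lepi bpr)).
rewrite leNgt; apply/negP => hlt.
have : cos (acos (circle_dot p r))
    < cos (acos (circle_dot p q) + acos (circle_dot q r)).
  by rewrite ltr_cos// in_itv/= ?addr_ge0 ?acos_ge0 ?acos_lepi ?(ltW hpi).
rewrite cosD !acosK ?in_itv//= !sin_acos//.
pose cross (u v : circle R) : R := (val u).1 * (val v).2 - (val u).2 * (val v).1.
have dotE u v : 1 - circle_dot u v ^+ 2 = cross u v ^+ 2.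
  have su := circle_sqr u; have sv := circle_sqr v.
  rewrite /circle_dot /cross; move: (val u) (val v) su sv => [a b] [c d] /= su sv.
  rewrite -[X in X - _]mulr1 -{1}su -sv; ring.
rewrite !dotE !sqrtr_sqr -normrM.
have -> : circle_dot p r = circle_dot p q * circle_dot q r - cross p q * cross q r.
  have := circle_sqr q; rewrite /circle_dot /cross.
  move: (val p) (val q) (val r) => [a b] [c d] [e f] /= sq.
  rewrite -[LHS]mul1r -sq; ring.
by rewrite ltrD2l ltrN2 ltNge ler_norm.
Qed.

HB.instance Definition _ := @isMetric.Build R (circle R) circle_dist
  circle_distxx circle_dist_positivity circle_dist_sym circle_dist_triangle.

End circle_metric.

(* The tree E: three segments [0, E_leg i] glued at their endpoint 0. The point
   at distance t from the branch point on segment i is the pair (i, t); of the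
   three pairs (i, 0), which are identified, only (ord0, 0) is kept. *)
Definition E_leg (R : realType) (i : 'I_3) : R :=
  tnth [tuple pi / 2; pi / 2; pi / 4] i.

Definition E_pred (R : realType) : pred ('I_3 * R) := fun x =>
  (0 <= x.2 <= E_leg R x.1) && ((x.2 == 0) ==> (x.1 == ord0)).

Definition treeE (R : realType) : Type := {x : 'I_3 * R | E_pred x}.

Section treeE_metric.
Context {R : realType}.
Implicit Types x y z : treeE R.

HB.instance Definition _ := Choice.copy (treeE R) {x : 'I_3 * R | E_pred x}.

Definition treeE_dist x y : R :=
  if (val x).1 == (val y).1 then `|(val x).2 - (val y).2|
  else (val x).2 + (val y).2.

Lemma treeE_ge0 x : 0 <= (val x).2.
Proof. by case/andP: (valP x) => /andP[]. Qed.

Lemma treeE_distxx x : treeE_dist x x = 0.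
Proof. by rewrite /treeE_dist eqxx subrr normr0. Qed.

Lemma treeE_dist_positivity x y : treeE_dist x y = 0 -> x = y.
Proof.
move=> h; apply: val_inj; move: h (treeE_ge0 x) (treeE_ge0 y).
case/andP: (valP x) => _ +; case/andP: (valP y) => _.
rewrite /treeE_dist; move: (val x) (val y) => [i s] [j t] /= hj hi.
case: eqVneq => [-> /normr0_eq0/subr0_eq -> _ _ //|ij] /eqP + s0 t0.
rewrite paddr_eq0// => /andP[s0' t0'].
by move: ij; rewrite (eqP (implyP hi s0')) (eqP (implyP hj t0')) eqxx.
Qed.

Lemma treeE_dist_sym x y : treeE_dist x y = treeE_dist y x.
Proof. by rewrite /treeE_dist eq_sym distrC [X in if _ then _ else X]addrC. Qed.

Lemma treeE_dist_triangle y x z :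
  treeE_dist x z <= treeE_dist x y + treeE_dist y z.
Proof.
move: (treeE_ge0 x) (treeE_ge0 y) (treeE_ge0 z); rewrite /treeE_dist.
move: (val x) (val y) (val z) => [i r] [j s] [k t] /= r0 s0 t0.
have [<-|ij] := eqVneq i j.
  by case: eqVneq => _; [exact: ler_distD|have := ler_norm (r - s); lra].
have [<-|jk] := eqVneq j k.
  by rewrite (negPf ij); have := ler_norm (t - s); rewrite distrC; lra.
by case: eqVneq => _; [rewrite ler_norml; apply/andP; split; lra|lra].
Qed.

HB.instance Definition _ := @isMetric.Build R (treeE R) treeE_dist
  treeE_distxx treeE_dist_positivity treeE_dist_sym treeE_dist_triangle.

End treeE_metric.

(* Main.v *)
Require Import Defs.
From mathcomp Require Import all_boot all_order all_algebra.
From mathcomp Require Import ring lra.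
From mathcomp Require Import all_classical all_reals all_analysis.

Set Implicit Arguments.
Unset Strict Implicit.
Unset Printing Implicit Defensive.

Import Order.TTheory GRing.Theory Num.Theory.
Import numFieldNormedType.Exports.

Local Open Scope classical_set_scope.
Local Open Scope ring_scope.

(** A complete R-tree of finite length is compact, so that the Gromov-Hausdorff
    distance to the circle is attained by a closed correspondence r, of
    distortion at most pi / 2 (GH_dist_closed_relation). In a tree, distances
    satisfy the four-point condition (four_point), and the length is at least
    the sum of what each new point adds to the subtree spanned by the previous
    ones (greedy_length). With these two facts the theorem comes down to
    comparing the distances between finitely many well chosen points.

    If a point y of the tree is related to q on the circle, the points related
    to angles close to the antipode of q are far from y and all lie in the same
    branch at y. Following this branch step after step cannot go on for ever,
    and at a point m where the process turns back, two branches are involved: m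
    is related to two points of the circle at distance exactly pi / 2, say at
    the angles - 3 * pi / 4 and 3 * pi / 4, and it separates points u and v
    related to the opposite angles pi / 4 and - pi / 4 (branch_point_exists).
    The distortion forces d m u = d m v = pi / 2 and d u v = pi: this gives two
    legs of E and a length of pi. Approaching the angle 0 from both sides gives
    points y and y' at distance pi / 4 from m in the branches of u and v
    (configuration_exists).

    A point c related to the angle pi is at distance at least pi / 2 from y and
    y'. If c is outside the branches of u and v, it is at distance at least
    pi / 4 from m; with the bound 5 * pi / 4 on the length, d c m = pi / 4 and
    the tree is the union of the three legs (tripod_exists, tripod_isometric).
    If c were in the branch of u, the subtree spanned by v, u, y and c would
    already have the maximal length (antipodal_side), and the points related to
    angles just beyond pi, which lie in this subtree close to c, would be too
    close to u (antipodal_not_side). *)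

(** * Concatenation of geodesics *)

Section trees.
Context {R : realType} {X : metricType R}.
Implicit Types (x y z v w : X) (g : R -> X) (s t : R).
Local Notation d := (@mdist R X).

Lemma lipschitz_within (A : set R) (g : R -> X) (K : R) :
  (forall s t, A s -> A t -> d (g s) (g t) <= K * `|s - t|) ->
  {within A, continuous g}.
Proof.
move=> gK; apply/subspace_continuousP => s As.
apply/(metricType_numDomainType.cvgrPdist_lt) => e e0.
rewrite near_withinE; near=> t => At.
rewrite (le_lt_trans (gK _ _ As At))//.
have K1 : 0 < `|K| + 1 by rewrite ltr_wpDl.
have st : `|s - t| < e / (`|K| + 1).
  by near: t; apply: (@cvgr_dist_lt _ _ _ (nbhs s)) => //; rewrite divr_gt0.
rewrite ltr_pdivlMr// in st; rewrite (le_lt_trans _ st)// mulrC.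
by apply: ler_wpM2l => //; rewrite (le_trans (ler_norm K))// lerDl.
Unshelve. all: by end_near. Qed.

Lemma lipschitz_continuous (h : X -> R) (K : R) :
  (forall x y, `|h x - h y| <= K * d x y) -> continuous h.
Proof.
move=> hK x; apply/(@pseudometric_normed_Zmodule.cvgrPdist_lt _ R^o) => e e0.
near=> y; rewrite (le_lt_trans (hK _ _))//.
have K1 : 0 < `|K| + 1 by rewrite ltr_wpDl.
have st : d x y < e / (`|K| + 1).
  near: y; apply: (@metricType_numDomainType.cvgr_dist_lt _ _ _ (nbhs x)) => //.
  by rewrite divr_gt0.
rewrite ltr_pdivlMr// in st; rewrite (le_lt_trans _ st)// mulrC.
by apply: ler_wpM2l; rewrite ?mdist_ge0// (le_trans (ler_norm K))// lerDl.
Unshelve. all: by end_near. Qed.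

Definition geodesic_path g x y : Prop :=
  [/\ g 0 = x, g (d x y) = y & forall s t, 0 <= s <= d x y ->
    0 <= t <= d x y -> d (g s) (g t) = `|s - t|].

(** The arc parametrization is the concatenation, rescaled to [0, 1]. Its
    inverse is read off from distances: the distance to x on the first piece,
    d x w plus the distance to w on the second. These two formulas agree at w,
    the only common point, and the pieces are closed, so that the inverse is
    continuous. *)
Lemma concat_arc x w y g1 g2 : x <> w ->
  geodesic_path g1 x w -> geodesic_path g2 w y ->
  (forall s t, 0 <= s <= d x w -> 0 <= t <= d w y -> g1 s = g2 t -> t = 0) ->
  arc_between x y (g1 @` `[0, d x w] `|` g2 @` `[0, d w y]).
Proof.
move=> xw [g10 g11 gE1] [g20 g21 gE2] disj.
set a := d x w; set b := d w y.
have a0 : 0 < a by rewrite mdist_gt0; apply/eqP.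
have b0 : 0 <= b := mdist_ge0 _ _.
pose D := a + b; have D0 : 0 < D by rewrite ltr_wpDr.
(* g is the concatenation, h its inverse *)
pose g s := if D * s <= a then g1 (D * s) else g2 (D * s - a).
pose A1 := g1 @` `[0, a]; pose A2 := g2 @` `[0, b].
pose h v := if v \in A1 then d x v / D else (a + d w v) / D.
have D01 s : 0 <= s <= 1 -> 0 <= D * s <= D.
  by case/andP => s0 s1; apply/andP; split; nra.
have d1 s : 0 <= s <= a -> d x (g1 s) = s.
  move=> sa; rewrite -{1}g10 gE1 ?lexx ?(ltW a0)// sub0r normrN ger0_norm//.
  by case/andP: sa.
have d2 t : 0 <= t <= b -> d w (g2 t) = t.
  move=> tb; rewrite -{1}g20 gE2 ?lexx// sub0r normrN ger0_norm//.
  by case/andP: tb.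
have d3 s : 0 <= s <= a -> d (g1 s) w = a - s.
  move=> /andP[s0 sa]; rewrite -{1}g11 gE1 ?lexx ?(ltW a0) ?s0//.
  by rewrite -/a distrC ger0_norm// subr_ge0.
have hg s : 0 <= s <= 1 -> h (g s) = s.
  move=> s01; have /andP[Ds0 DsD] := D01 _ s01.
  have [sa|sa] := leP (D * s) a; rewrite /g /h ?sa ?(lt_geF sa).
    rewrite ifT; last by apply/mem_set; exists (D * s) => //=; rewrite in_itv/= Ds0.
    by rewrite d1 ?Ds0// mulrAC divff ?mul1r// gt_eqF.
  have sb : 0 <= D * s - a <= b by rewrite subr_ge0 (ltW sa)/= lerBlDl.
  rewrite ifF; last first.
    apply/negbTE/negP => /set_mem[t /=]; rewrite in_itv/= => ta /(disj _ _ ta sb)/eqP.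
    by rewrite subr_eq0 gt_eqF.
  by rewrite d2// addrC subrK mulrAC divff ?mul1r// gt_eqF.
have gmix s t : 0 <= s <= 1 -> 0 <= t <= 1 -> D * s <= a -> a < D * t ->
    d (g s) (g t) <= D * (t - s).
  move=> /D01/andP[s0 _] /D01/andP[t0 tD] sa ta; rewrite /g sa (lt_geF ta).
  rewrite (le_trans (metric_triangle _ w _))// d3 ?s0// d2; last first.
    by rewrite subr_ge0 (ltW ta)/= lerBlDl.
  by rewrite le_eqVlt; apply/orP; left; apply/eqP; ring.
have gLip s t : `[0, 1]%classic s -> `[0, 1]%classic t ->
    d (g s) (g t) <= D * `|s - t|.
  rewrite /= !in_itv/= => s01 t01.
  have /andP[s0 sD] := D01 _ s01; have /andP[t0 tD] := D01 _ t01.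
  have [sa|sa] := leP (D * s) a; have [ta|ta] := leP (D * t) a.
  - rewrite /g sa ta gE1 ?s0 ?t0// -mulrBr normrM gtr0_norm//.
  - rewrite (le_trans (gmix _ _ s01 t01 sa ta))// ler_wpM2l ?(ltW D0)//.
    by rewrite distrC ler_norm.
  - rewrite metric_sym (le_trans (gmix _ _ t01 s01 ta sa))//.
    by rewrite ler_wpM2l ?(ltW D0)// ler_norm.
  - rewrite /g (lt_geF sa) (lt_geF ta) gE2 ?subr_ge0 ?(ltW sa) ?(ltW ta) ?lerBlDl//.
    by rewrite opprB addrA subrK -mulrBr normrM gtr0_norm.
have gc (c : R) f p q : (forall s t, 0 <= s <= c -> 0 <= t <= c ->
    d (f s) (f t) = `|s - t|) -> p = f -> q = c -> closed (p @` `[0, q]).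
  move=> fE -> ->; apply: compact_closed; first exact: metric_hausdorff.
  apply: continuous_compact; last exact: segment_compact.
  by apply: (@lipschitz_within _ _ 1) => s t; rewrite /= !in_itv/= mul1r => sc tc;
     rewrite fE.
exists g; split; last 2 first.
- by rewrite /g mulr0 (ltW a0) g10.
- rewrite /g mulr1 /D; case: leP => [|_]; last by rewrite addrAC subrr add0r.
  rewrite gerDl => b0'; have wy : w = y.
    by apply: mdist_positivity; apply/eqP; rewrite eq_le b0' b0.
  by move: b0' g21; rewrite /b -wy mdistxx addr0 g11.
split.
- split.
  + move=> s /=; rewrite in_itv/= => /D01/andP[s0 sD].
    rewrite /g; case: leP => sa; [left|right].
      by exists (D * s) => //=; rewrite in_itv/= s0.
    by exists (D * s - a) => //=; rewrite in_itv/= subr_ge0 (ltW sa) lerBlDl.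
  + move=> s t /set_mem/=; rewrite in_itv/= => s01 /set_mem/=; rewrite in_itv/= => t01 gst.
    by rewrite -(hg s)// gst hg.
  + move=> v [] [s /=]; rewrite in_itv/= => /andP[s0 sa] <-.
      have sD : s / D * D = s by rewrite divfK// gt_eqF.
      exists (s / D); last by rewrite /g mulrC sD sa.
      by rewrite /= in_itv/= divr_ge0 ?(ltW D0)//= ler_pdivrMr// mul1r (le_trans sa)// lerDl.
    have sD : (s + a) / D * D = s + a by rewrite divfK// gt_eqF.
    exists ((s + a) / D); last first.
      rewrite /g mulrC sD addrK; case: leP => //; rewrite gerDr => s0'.
      have -> : s = 0 by apply/eqP; rewrite eq_le s0 s0'.
      by rewrite add0r g11 g20.
    rewrite /= in_itv/= divr_ge0 ?addr_ge0 ?(ltW D0) ?(ltW a0)//=.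
    by rewrite ler_pdivrMr// mul1r addrC lerD2l.
- exact: lipschitz_within gLip.
- exists h; last by move=> s /set_mem/=; rewrite in_itv/=; exact: hg.
  apply: withinU_continuous; [exact: (gc _ _ _ _ gE1)|exact: (gc _ _ _ _ gE2)| |].
    apply: (@subspace_eq_continuous _ _ _ (fun v => d x v / D)).
      by move=> v vA; rewrite /h /from_subspace ifT.
    apply: continuous_subspaceT; apply: (@lipschitz_continuous _ D^-1) => u v.
    rewrite -mulrBl normrM [X in _ * X]gtr0_norm ?invr_gt0// mulrC ler_wpM2l ?invr_ge0 ?(ltW D0)//.
    have := metric_triangle x u v; have := metric_triangle x v u.
    by rewrite (metric_sym v u) ler_norml => *; apply/andP; split; lra.
  apply: (@subspace_eq_continuous _ _ _ (fun v => (a + d w v) / D)).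
    move=> v /set_mem vA; rewrite /h /from_subspace; case: ifPn => // /set_mem[s /=].
    rewrite in_itv/= => sa sv; case: vA => t /=; rewrite in_itv/= => tb tv.
    have t0 : t = 0 by apply: disj sa tb _; rewrite sv.
    by move: tv; rewrite t0 g20 => <-; rewrite mdistxx addr0.
  apply: continuous_subspaceT; apply: (@lipschitz_continuous _ D^-1) => u v.
  rewrite -mulrBl normrM [X in _ * X]gtr0_norm ?invr_gt0// mulrC ler_wpM2l ?invr_ge0 ?(ltW D0)//.
  have := metric_triangle w u v; have := metric_triangle w v u.
  by rewrite (metric_sym v u) ler_norml => *; apply/andP; split; lra.
Qed.

End trees.

(** * R-trees are 0-hyperbolic *)

Section rtrees.
Context {R : realType} {X : metricType R}.
Hypothesis rt : Rtree X.
Implicit Types (x y z v w : X) (g : R -> X) (s t : R).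
Local Notation d := (@mdist R X).

(** A geodesic segment is only known to be isometric to some interval; its
    isometry f may reverse the direction from x to y, whence the sign sg, and
    it need not send x and y to the ends of the interval, which is harmless
    since the interval contains everything between f x and f y. *)
Lemma geodesic_exists x y : exists g, geodesic_path g x y.
Proof.
have [<-|/eqP xy] := eqVneq x y.
  exists (fun=> x); split => // s t; rewrite mdistxx => s0 t0.
  by rewrite -(le_anti s0) -(le_anti t0) subr0 normr0.
have [_ /(_ x y xy)[A [[g [[[gA ginj gsurj] _ _] g0 g1]] _ [I [f fd fI]]]]] := rt.
have Ax : A x by rewrite -g0; apply: gA; rewrite /= in_itv/= lexx ler01.
have Ay : A y by rewrite -g1; apply: gA; rewrite /= in_itv/= lexx ler01.
have {}fd u v : A u -> A v -> `|f u - f v| = d u v.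
  by move=> Au Av; rewrite distrC -fd ?inE// /mdist/=.
have fAI u : A u -> f u \in I.
  by move=> Au; have : [set` I] (f u) by rewrite -fI; exists u.
pose sg : R := if f x <= f y then 1 else -1.
have sg1 : `|sg| = 1 by rewrite /sg; case: ifP; rewrite ?normrN normr1.
have fy : f y = f x + sg * d x y.
  rewrite -fd// /sg; case: ifPn => [xy'|]; last first.
    by rewrite -ltNge => yx; rewrite gtr0_norm ?subr_gt0//; ring.
  by rewrite ler0_norm ?subr_le0//; ring.
have seg t : 0 <= t <= d x y -> exists v, A v /\ f v = f x + sg * t.
  move=> /andP[t0 td].
  have : [set` I] (f x + sg * t).
    move: fy; rewrite /sg; case: ifPn => xy' fy.
      apply: (interval_is_interval (fAI _ Ax) (fAI _ Ay)).
      by rewrite fy; apply/andP; split; lra.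
    apply: (interval_is_interval (fAI _ Ay) (fAI _ Ax)).
    by rewrite fy; apply/andP; split; lra.
  by rewrite -fI => -[v Av fv]; exists v.
have /choice[g' g'P] : forall t, exists v, 0 <= t <= d x y ->
    A v /\ f v = f x + sg * t.
  move=> t; have [/seg[v vP]|_] := boolP (0 <= t <= d x y); last by exists x.
  by exists v.
have finj u v : A u -> A v -> f u = f v -> u = v.
  by move=> Au Av fuv; apply: mdist_positivity; rewrite -fd// fuv subrr normr0.
exists g'; split.
- have [|A0 f0] := g'P 0; first by rewrite lexx mdist_ge0.
  by apply: finj => //; rewrite f0 mulr0 addr0.
- have [|A0 f0] := g'P (d x y); first by rewrite lexx mdist_ge0.
  by apply: finj => //; rewrite f0 fy.
- move=> s t /g'P[As fs] /g'P[At ft].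
  by rewrite -fd// fs ft opprD addrACA subrr add0r -mulrBr normrM sg1 mul1r.
Qed.

Lemma geodesic_distl g x y s : geodesic_path g x y -> 0 <= s <= d x y ->
  d x (g s) = s.
Proof.
move=> [g0 _ gd] sd; rewrite -{1}g0 gd ?lexx ?mdist_ge0// sub0r normrN.
by rewrite ger0_norm//; case/andP: sd.
Qed.

Lemma geodesic_distr g x y s : geodesic_path g x y -> 0 <= s <= d x y ->
  d (g s) y = d x y - s.
Proof.
move=> [_ g1 gd] /andP[s0 sd]; rewrite -{1}g1 gd ?s0 ?lexx ?mdist_ge0//.
by rewrite distrC ger0_norm// subr_ge0.
Qed.

Lemma geodesic_rev g x y : geodesic_path g x y ->
  geodesic_path (fun t => g (d x y - t)) y x.
Proof.
move=> [g0 g1 gd]; rewrite /geodesic_path (metric_sym y x); split.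
- by rewrite subr0.
- by rewrite subrr.
- move=> s t /andP[s0 s1] /andP[t0 t1]; rewrite gd.
  + by rewrite opprB addrC addrA subrK distrC.
  + by rewrite subr_ge0 s1/= gerBl.
  + by rewrite subr_ge0 t1/= gerBl.
Qed.

Lemma geodesic_take g x y s : geodesic_path g x y -> 0 <= s <= d x y ->
  geodesic_path g x (g s).
Proof.
move=> gg sd; have := geodesic_distl gg sd; case: gg => g0 g1 gd e.
rewrite /geodesic_path e; split => // u v /andP[u0 us] /andP[v0 vs].
case/andP: sd => _ sd.
by apply: gd; rewrite ?u0 ?v0 (le_trans _ sd).
Qed.

Lemma geodesic_drop g x y s : geodesic_path g x y -> 0 <= s <= d x y ->
  geodesic_path (fun t => g (s + t)) (g s) y.
Proof.
move=> gg sd; have := geodesic_distr gg sd; case: gg => g0 g1 gd e.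
rewrite /geodesic_path e; split; first by rewrite addr0.
  by rewrite addrC subrK.
move=> u v /andP[u0 us] /andP[v0 vs]; case/andP: sd => s0 sd.
rewrite gd; first by rewrite opprD addrACA subrr add0r.
  by rewrite addr_ge0//= -lerBrDl.
by rewrite addr_ge0//= -lerBrDl.
Qed.

Lemma geodesic_cst y : geodesic_path (fun=> y) y y.
Proof.
split=> // s t; rewrite mdistxx => s0 t0.
by rewrite -(le_anti s0) -(le_anti t0) subr0 normr0.
Qed.

Lemma geodesic_arc g x y : x <> y -> geodesic_path g x y ->
  arc_between x y (g @` `[0, d x y]).
Proof.
move=> xy gg.
suff -> : g @` `[0, d x y] = g @` `[0, d x y] `|` (fun=> y) @` `[0, d y y].
  by apply: concat_arc (geodesic_cst y) _ => // s t _; rewrite mdistxx => /le_anti.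
apply/esym/setUidl => _ [t _ <-]; exists (d x y); last by case: gg.
by rewrite /= in_itv/= lexx mdist_ge0.
Qed.

Lemma arc_between_geodesic g x y B : x <> y ->
  geodesic_path g x y -> arc_between x y B -> B = g @` `[0, d x y].
Proof.
move=> xy gg Bxy; have [A [_ Auniq _]] := proj2 rt x y xy.
by rewrite (Auniq _ Bxy); apply/esym/Auniq/geodesic_arc.
Qed.

Lemma arc_between_dist x y B v : x <> y ->
  arc_between x y B -> B v -> d x v + d v y = d x y.
Proof.
move=> xy Bxy Bv.
have [g gg] := geodesic_exists x y.
move: Bv; rewrite (arc_between_geodesic xy gg Bxy) => -[t /=].
rewrite in_itv/= => td <-.
by rewrite (geodesic_distl gg td) (geodesic_distr gg td) addrC subrK.
Qed.

(** Where the tree hypothesis enters: two geodesics that only meet at their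
    common end w form an arc, which by uniqueness is the geodesic segment from
    x to y, so that all its points lie between x and y. *)
Lemma concat_dist x w y g1 g2 :
  geodesic_path g1 x w -> geodesic_path g2 w y ->
  (forall s t, 0 <= s <= d x w -> 0 <= t <= d w y -> g1 s = g2 t -> t = 0) ->
  forall v, (g1 @` `[0, d x w] `|` g2 @` `[0, d w y]) v ->
  d x v + d v y = d x y.
Proof.
move=> gg1 gg2 disj v; have [xw|/eqP xw] := eqVneq x w.
  case => -[t /=]; rewrite in_itv/= => td <-.
    move: td; rewrite xw mdistxx => /le_anti <-.
    by case: gg1 => -> _ _; rewrite xw mdistxx add0r.
  by rewrite xw (geodesic_distl gg2 td) (geodesic_distr gg2 td) addrC subrK.
have A := concat_arc xw gg1 gg2 disj.
have [xy|xy] := pselect (x = y); last exact: arc_between_dist A.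
exfalso; have xw0 : d w x = 0.
  apply: (disj 0 (d w x)) => //.
  - by rewrite lexx mdist_ge0.
  - by rewrite -xy lexx mdist_ge0.
  - by case: gg1 => -> _ _; case: gg2; rewrite -xy => _ -> _.
by apply: xw; apply/esym/mdist_positivity.
Qed.

Lemma geodesic_unique g x y v : geodesic_path g x y ->
  d x v + d v y = d x y -> v = g (d x v).
Proof.
move=> gg xvy; have [xv|/eqP xv] := eqVneq x v.
  by rewrite -xv mdistxx; case: gg.
have [xy|xy] := pselect (x = y).
  exfalso; apply: xv; apply: mdist_positivity; move: xvy.
  have := mdist_ge0 x v; have := mdist_ge0 v y; rewrite -xy mdistxx; lra.
have [g1 gg1] := geodesic_exists x v; have [g2 gg2] := geodesic_exists v y.
have : g @` `[0, d x y] = g1 @` `[0, d x v] `|` g2 @` `[0, d v y].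
  apply/esym/arc_between_geodesic => //; apply: concat_arc => // s t sd td st.
  have := metric_triangle x (g1 s) y.
  rewrite (geodesic_distl gg1 sd) st (geodesic_distr gg2 td).
  by case/andP: sd => _ sd; case/andP: td => t0 td; lra.
move/seteqP => [_ /(_ v)][].
  left; exists (d x v); last by case: gg1.
  by rewrite /= in_itv/= lexx mdist_ge0.
move=> t /=; rewrite in_itv/= => td gt.
by have := geodesic_distl gg td; rewrite gt => ->.
Qed.

(** The Gromov product of x and y based at z. In a tree it is the length of the
    common part of the segments from z to x and from z to y, and also the
    distance from z to the segment from x to y; it is positive exactly when x
    and y are in the same branch at z. *)
Definition gromov z x y : R := (d z x + d z y - d x y) / 2.

(** Let r be the last parameter at which the two geodesics agree. Beyond r they
    never meet again, so that d x y = d x (gx r) + d (gx r) y, which says that r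
    is the Gromov product; before r they agree because geodesics are unique. *)
Lemma gromov_common x y z gx gy : geodesic_path gx z x -> geodesic_path gy z y ->
  forall s, 0 <= s <= gromov z x y -> gx s = gy s.
Proof.
move=> ggx ggy; set a := d z x; set b := d z y.
pose S := [set s | 0 <= s <= Num.min a b /\ gx s = gy s].
have S0 : S 0.
  by split; [rewrite lexx le_min !mdist_ge0|case: ggx => ->; case: ggy => ->].
have Sub s : S s -> s <= Num.min a b by case => /andP[].
have hS : has_sup S by split; [exists 0|exists (Num.min a b)].
pose r := sup S.
have r0 : 0 <= r by apply: sup_upper_bound.
have rle : r <= Num.min a b by apply: ge_sup; [exists 0|].
have [ra rb] : r <= a /\ r <= b by move: rle; rewrite le_min => /andP.
have grE : gx r = gy r.
  apply: mdist_positivity; apply/eqP; rewrite eq_le mdist_ge0 andbT.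
  apply/ler_addgt0Pl => e e0; rewrite addr0.
  have e2 : 0 < e / 2 by rewrite divr_gt0.
  have [s [/andP[s0]]] := sup_adherent e2 hS.
  rewrite le_min => /andP[sa sb] gs; rewrite -/r => rs.
  have sr : s <= r.
    by apply: sup_upper_bound => //; split => //; rewrite s0 le_min sa.
  rewrite (le_trans (metric_triangle _ (gx s) _))// {2}gs.
  case: ggx => _ _ ->; rewrite ?r0 ?s0//; case: ggy => _ _ ->; rewrite ?r0 ?s0//.
  by rewrite distrC ler0_norm ?subr_le0//; lra.
have ra' : 0 <= r <= d z x by rewrite r0.
have rb' : 0 <= r <= d z y by rewrite r0.
have dxr := geodesic_distr ggx ra'; rewrite -/a in dxr.
have dyr := geodesic_distr ggy rb'; rewrite -/b in dyr.
have ggx' := geodesic_rev (geodesic_drop ggx ra').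
have ggy' := geodesic_drop ggy rb'; rewrite -grE in ggy' dyr.
have xry : d x (gx r) + d (gx r) y = d x y.
  apply: (concat_dist ggx' ggy'); last first.
    left; exists (d x (gx r)); last by case: ggx'.
    by rewrite /= in_itv/= lexx mdist_ge0.
  move=> s t; rewrite (metric_sym x) dxr dyr => /andP[s0 sa] /andP[t0 tb].
  have -> : r + (a - r - s) = a - s by ring.
  move=> gst.
  have as0 : 0 <= a - s <= a by apply/andP; split; lra.
  have rt0 : 0 <= r + t <= b by apply/andP; split; lra.
  have e : a - s = r + t.
    by rewrite -(geodesic_distl ggx as0) gst (geodesic_distl ggy rt0).
  apply/eqP; rewrite eq_le t0 andbT -(lerD2l r) addr0 -e.
  apply: sup_upper_bound => //; split; last by rewrite {2}e.
  by case/andP: as0 => -> ?; rewrite le_min e; apply/andP; split; lra.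
move=> s; have -> : gromov z x y = r.
  by move: xry; rewrite /gromov (metric_sym x (gx r)) dxr dyr -/a -/b; lra.
move=> /andP[s0 sr].
have sa : 0 <= s <= d z x by rewrite s0 (le_trans sr).
have ggr := geodesic_take ggy rb'.
have zsr : d z (gx s) + d (gx s) (gy r) = d z (gy r).
  rewrite -grE (geodesic_distl ggx sa) (geodesic_distl ggx ra').
  have [_ _ ->] := ggx; [|by []|by []].
  by rewrite ler0_norm ?subr_le0//; lra.
by rewrite [LHS](geodesic_unique ggr zsr) (geodesic_distl ggx sa).
Qed.

Lemma gromov_ge0 z x y : 0 <= gromov z x y.
Proof.
by rewrite /gromov divr_ge0// subr_ge0 (metric_sym z x) metric_triangle.
Qed.

Lemma gromov_le z x y : gromov z x y <= d z x.
Proof. by rewrite /gromov; have := metric_triangle z x y; lra. Qed.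

Lemma gromovC z x y : gromov z x y = gromov z y x.
Proof. by rewrite /gromov (addrC (d z x)) (metric_sym x y). Qed.

(** The geodesics to x and to w both follow the geodesic to y up to the smaller
    of the two Gromov products. *)
Lemma gromov_hyperbolic z x y w :
  Num.min (gromov z x y) (gromov z y w) <= gromov z x w.
Proof.
set s := Num.min _ _.
have s0 : 0 <= s by rewrite le_min !gromov_ge0.
have [sxy syw] : s <= gromov z x y /\ s <= gromov z y w.
  by rewrite /s !ge_min !lexx orbT.
have [gx ggx] := geodesic_exists z x; have [gy ggy] := geodesic_exists z y.
have [gw ggw] := geodesic_exists z w.
have : gx s = gw s.
  by rewrite (gromov_common ggx ggy) ?s0 ?sxy// (gromov_common ggy ggw) ?s0 ?syw.
have sx : 0 <= s <= d z x by rewrite s0 (le_trans sxy) ?gromov_le.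
have sw : 0 <= s <= d z w by rewrite s0 (le_trans syw) ?(gromovC z y) ?gromov_le.
have sxz := geodesic_distr ggx sx; have swz := geodesic_distr ggw sw.
move=> e; have := metric_triangle x (gx s) w.
rewrite (metric_sym x (gx s)) sxz e swz /gromov.
lra.
Qed.

(** The same inequality, written with distances: of the three sums of opposite
    distances between four points, none exceeds the maximum of the others. *)
Lemma four_point x y z w :
  d x y + d z w <= Num.max (d x z + d y w) (d x w + d y z).
Proof.
have := gromov_hyperbolic w x z y; rewrite /gromov ge_min le_max.
rewrite (metric_sym w x) (metric_sym w y) (metric_sym w z) (metric_sym y z).
by case/orP => h; apply/orP; [left|right]; lra.
Qed.

Lemma geodesic_point x y s : 0 <= s <= d x y ->
  exists v, d x v = s /\ d v y = d x y - s.
Proof.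
move=> sd; have [g gg] := geodesic_exists x y; exists (g s).
by rewrite (geodesic_distl gg sd) (geodesic_distr gg sd).
Qed.

End rtrees.

(** * Lower bounds for the length of a tree *)

Section length.
Context {R : realType} {X : metricType R}.
Hypothesis rt : Rtree X.
Variable L : R.
Hypothesis lenL : (tree_length X <= L%:E)%E.
Implicit Types (x y z v w : X) (a b u : nat -> X).
Local Notation d := (@mdist R X).

Definition segment x y : set X := [set v | d x v + d v y = d x y].

Lemma segmentE g x y : geodesic_path g x y -> segment x y = g @` `[0, d x y].
Proof.
move=> gg; apply/seteqP; split => [v xvy|v [t /=]].
  exists (d x v); last by rewrite -(geodesic_unique rt gg).
  by rewrite /= in_itv/= mdist_ge0 -xvy lerDl mdist_ge0.
rewrite in_itv/= => td <-; rewrite /segment/=.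
by rewrite (geodesic_distl gg td) (geodesic_distr gg td) addrC subrK.
Qed.

Lemma segment_arc_between x y : x <> y -> arc_between x y (segment x y).
Proof.
move=> xy; have [g gg] := geodesic_exists rt x y.
by rewrite (segmentE gg); exact: geodesic_arc.
Qed.

Lemma arc_length_segment x y : x <> y ->
  ((d x y)%:E <= arc_length (segment x y))%E.
Proof.
move=> /segment_arc_between[g [gp g0 g1]]; apply: ereal_sup_ubound.
exists g, [:: 1]; split => //; first by apply: itv_partition1; exact: ltr01.
by rewrite /inscribed_length/= big_nat1/= g0 g1.
Qed.

(** Degenerate segments are allowed: they contribute 0 to the sum and are left
    out of the family P of arcs, whence the hypotheses a i <> b i. *)
Lemma disjoint_segments_length (n : nat) a b :
  (forall i j, (i < n)%N -> (j < n)%N -> i <> j -> a i <> b i -> a j <> b j ->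
    segment (a i) (b i) `&` segment (a j) (b j) = set0) ->
  \sum_(i < n) d (a i) (b i) <= L.
Proof.
move=> disj; rewrite -lee_fin; apply: (le_trans _ lenL).
pose P := `I_n `&` [set k | a k <> b k].
pose S k := segment (a k) (b k).
have SP k : S k (a k) by rewrite /S /segment/= mdistxx add0r.
have Sinj : set_inj P S.
  move=> i j /set_mem[/= ni abi] /set_mem[/= nj abj] Sij.
  apply: contrapT => ij; have := disj _ _ ni nj ij abi abj.
  by move/seteqP => [/(_ (a i)) + _]; apply; split; rewrite -/(S _) -?Sij.
apply: (@le_trans _ _ (\esum_(A in S @` P) arc_length A)%E); last first.
  apply: ereal_sup_ubound; exists (S @` P) => //; split.
    move=> _ [k [_ abk] <-]; have [g [gp _ _]] := segment_arc_between abk.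
    by exists g.
  move=> _ _ [i [/= ni abi] <-] [j [/= nj abj] <-] [v [Si Sj]].
  congr S; apply: contrapT => ij; have := disj _ _ ni nj ij abi abj.
  by move/seteqP => [/(_ v) + _]; apply.
rewrite (@reindex_esum _ _ _ P (S @` P) S _ (inj_bij Sinj)); apply: esum_ge; exists P.
  by split => //; apply: finite_setIl; exact: finite_II.
rewrite -sumEFin (fsbig_ord _ n (fun k => (d (a k) (b k))%:E)).
rewrite -(@fsbig_widen _ _ _ _ P).
- apply: lee_fsum; first by apply: finite_setIl; exact: finite_II.
  by move=> k [_ abk]; exact: arc_length_segment.
- by move=> k [].
- move=> k [/= kn kP]; have [->|/eqP ab] := eqVneq (a k) (b k).
    by rewrite mdistxx.
  by exfalso; apply: kP.
Qed.

(** The subtree spanned by p, x 0, ..., x n grows one point at a time: gluing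
    x k adds at least the distance from x k to the union of the segments from p
    to the earlier points, that is, the smallest of the Gromov products below.
    This turns the length bound into linear inequalities between distances. *)
Lemma greedy_length (n : nat) (p : X) (x : nat -> X) (delta : nat -> R) :
  (forall k, (k < n)%N -> delta k <= d (x k) p /\
    forall i, (i < k)%N -> delta k <= gromov (x k) (x i) p) ->
  \sum_(k < n) delta k <= L.
Proof.
move=> xdelta; apply/ler_addgt0Pr => e e0.
(* the new segments are shortened by eta to make them disjoint *)
pose eta := e / n.+1%:R; have eta0 : 0 < eta by rewrite divr_gt0.
pose l k := Num.max 0 (delta k - eta).
have /choice[b bP] : forall k, exists v, (k < n)%N ->
    d (x k) v = l k /\ d v p = d (x k) p - l k.
  move=> k; have [kn|_] := boolP (k < n)%N; last by exists p.
  have [v vP] : exists v, d (x k) v = l k /\ d v p = d (x k) p - l k.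
    apply: geodesic_point => //; rewrite /l le_max lexx/= ge_max mdist_ge0/=.
    by have [+ _] := xdelta k kn; lra.
  by exists v.
have : \sum_(k < n) d (x k) (b k) <= L.
  apply: disjoint_segments_length => i j.
  wlog ij : i j / (i < j)%N.
    move=> wl ni nj ij abi abj; have [lt|gt|//] := ltngtP i j.
      exact: wl.
    by rewrite setIC; apply: wl => // /esym.
  move=> ni nj _ abi abj; apply/seteqP; split => // v [vi vj].
  have [xi bi] := bP i ni; have [xj bj] := bP j nj.
  have lj : l j = delta j - eta.
    move: xj; rewrite /l; case: ltP => // _ xj; exfalso; apply: abj.
    exact: mdist_positivity.
  have [_ /(_ i ij)] := xdelta j nj.
  rewrite /segment/= in vi vj; rewrite /gromov.
  have := metric_triangle v (b i) p.
  have := metric_triangle (x j) v (x i); have := metric_triangle (x j) v p.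
  have := mdist_ge0 v (b j).
  rewrite (metric_sym v (x i)).
  lra.
have : \sum_(k < n) (delta k - eta) = \sum_(k < n) delta k - eta * n%:R.
  by rewrite big_split/= sumr_const card_ord mulNrn mulr_natr.
have : eta * n%:R <= e.
  by rewrite /eta mulrAC ler_pdivrMr// ler_pM2l// ler_nat.
have : \sum_(k < n) (delta k - eta) <= \sum_(k < n) d (x k) (b k).
  apply: ler_sum => k _; have [-> _] := bP k (ltn_ord k).
  by rewrite /l le_max lexx orbT.
lra.
Qed.

End length.

(** * Compactness and optimal correspondences *)

Section compactness.
Context {R : realType}.

(** Sequential compactness without subsequences: a fixed ultrafilter gives limits
    of all sequences at once, compatibly with each other. *)
Definition has_ultralimits (M : metricType R) : Prop :=
  forall (U : set_system nat) (u : nat -> M), UltraFilter U ->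
  exists x : M, forall e, 0 < e -> U [set n | mdist x (u n) < e].

Lemma totally_bounded_ultralimits (M : metricType R) : complete_space M ->
  (forall e : R, 0 < e -> exists s : seq M,
     forall x, exists2 y, y \in s & mdist y x < e) ->
  has_ultralimits M.
Proof.
move=> cM tbM U u UU.
have PU : ProperFilter U by exact: ultra_proper.
have [|x Fx] := cM (u @ U) _.
  apply: cauchy_exP => e e0; have [s sP] := tbM e e0.
  apply: contrapT => /forallNP nF.
  have : (u @ U) [set x | forall y, y \in s -> ~ ball y e x].
    elim: s {sP} => [|y s ih]; first by apply: filterS filterT => x _ y.
    have [/nF//|nb] := in_ultra_setVsetC (u @^-1` ball y e) UU.
    have {}nb : (u @ U) (~` ball y e) := nb.
    apply: filterS2 nb ih => x bx sx z; rewrite inE => /orP[/eqP->//|].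
    exact: sx.
  move=> /filter_ex[x xs]; have [y ys yx] := sP x.
  by apply: (xs y ys); rewrite ballEmdist.
exists x => e e0; have := Fx (ball x e) (nbhsx_ballx _ _ e0).
by rewrite ballEmdist.
Qed.

(** From each of infinitely many e-separated points starts a segment of length
    e / 3, and these segments are disjoint: the length would be infinite. *)
Lemma Rtree_totally_bounded (X : metricType R) (L : R) : Rtree X ->
  (tree_length X <= L%:E)%E -> forall e : R, 0 < e -> exists s : seq X,
    forall x, exists2 y, y \in s & mdist y x < e.
Proof.
move=> rt lenL e e0; apply: contrapT => /forallNP nets.
have /choice[F FP] : forall s : seq X, exists x, forall y, y \in s -> e <= mdist y x.
  move=> s; apply: contrapT => /forallNP h; apply: (nets s) => x.
  apply: contrapT => h'; apply: (h x) => y ys; rewrite leNgt; apply/negP => yx.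
  by apply: h'; exists y.
pose s n := iter n (fun s => F s :: s) [::]; pose x n := F (s n).
have xs i j : (i < j)%N -> x i \in s j.
  elim: j => // j ih; rewrite ltnS leq_eqVlt => /orP[/eqP->|/ih].
    by rewrite /s iterS inE eqxx.
  by rewrite /s iterS inE orbC => ->.
have sep i j : i <> j -> e <= mdist (x i) (x j).
  wlog ij : i j / (i < j)%N.
    move=> wl ij; have [lt|gt|//] := ltngtP i j; first exact: wl.
    by rewrite metric_sym; apply: wl => // /esym.
  by move=> _; apply: FP; exact: xs.
have /choice[b bP] : forall k, exists v, mdist (x k) v = e / 3.
  move=> k; have [|v [vP _]] := @geodesic_point _ _ rt (x k) (x k.+1) (e / 3).
    have : e <= mdist (x k) (x k.+1) by apply: sep => /n_Sn.
    by move=> ?; apply/andP; split; lra.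
  by exists v.
have lenb n : \sum_(i < n) mdist (x i) (b i) <= L.
  apply: (disjoint_segments_length rt lenL) => i j _ _ ij _ _.
  apply/seteqP; split => // v [vi vj]; rewrite /segment/= !bP in vi vj.
  have := metric_triangle (x i) v (x j); have := sep i j ij.
  have := mdist_ge0 v (b i); have := mdist_ge0 v (b j).
  by rewrite (metric_sym v (x j)); lra.
have := lenb (Num.truncn (L / (e / 3))).+1.
under eq_bigr do rewrite bP.
rewrite sumr_const card_ord.
have e3 : 0 < e / 3 by rewrite divr_gt0.
rewrite -[X in X <= _]mulr_natl -ler_pdivlMr//.
by rewrite leNgt truncnS_gt.
Qed.

(** Two points are related when their copies in the ambient space are less than
    c apart. *)
Lemma GH_dist_relation (M N : metricType R) (c : R) : (GH_dist M N < c%:E)%E ->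
  exists r : M -> N -> Prop,
  [/\ forall x, exists p, r x p, forall p, exists x, r x p &
      forall x x' p p', r x p -> r x' p' ->
        `|mdist x x' - mdist p p'| <= 2 * c].
Proof.
move=> /ereal_inf_lt[_ [Z [M' [N' [[f fd fM] [g gd gN] ->]]]]].
rewrite gt_max => /andP[hM hN].
exists (fun x p => exists z w, [/\ M' z, N' w, f z = x, g w = p & mdist z w < c]).
have half (A B : set Z) z : (ereal_sup [set dist_to_set a B | a in A] < c%:E)%E ->
    A z -> exists2 w, B w & mdist z w < c.
  move=> h Az; have : (dist_to_set z B < c%:E)%E.
    by apply: le_lt_trans h; apply: ereal_sup_ubound; exists z.
  by move=> /ereal_inf_lt[_ [w Bw <-]]; rewrite lte_fin; exists w.
split.
- move=> x; have : [set: M] x by []; rewrite -fM => -[z Mz zx].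
  by have [w Nw zw] := half _ _ _ hM Mz; exists (g w), z, w.
- move=> p; have : [set: N] p by []; rewrite -gN => -[w Nw wp].
  by have [z Mz zw] := half _ _ _ hN Nw; exists (f z), z, w; rewrite metric_sym.
- move=> _ _ _ _ [z [w [Mz Nw <- <- zw]]] [z' [w' [Mz' Nw' <- <- zw']]].
  rewrite fd ?inE// gd ?inE//.
  have := metric_triangle z w z'; have := metric_triangle w w' z'.
  have := metric_triangle w z w'; have := metric_triangle z z' w'.
  rewrite (metric_sym w z) (metric_sym w' z') ler_norml => *.
  by apply/andP; split; lra.
Qed.

(** The limit, along an ultrafilter, of correspondences whose distortions
    tend to 2 * c; it is still a correspondence because sequences converge. *)
Lemma GH_dist_closed_relation (M N : metricType R) (c : R) :
  has_ultralimits M -> has_ultralimits N -> (GH_dist M N <= c%:E)%E ->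
  exists r : M -> N -> Prop,
  [/\ forall x, exists p, r x p, forall p, exists x, r x p,
      forall x x' p p', r x p -> r x' p' ->
        `|mdist x x' - mdist p p'| <= 2 * c &
      forall x p, (forall e, 0 < e -> exists x' p',
        [/\ r x' p', mdist x x' < e & mdist p p' < e]) -> r x p].
Proof.
move=> limM limN GHc.
have /choice[r rP] : forall n : nat, exists r : M -> N -> Prop,
  [/\ forall x, exists p, r x p, forall p, exists x, r x p &
      forall x x' p p', r x p -> r x' p' ->
        `|mdist x x' - mdist p p'| <= 2 * (c + n.+1%:R^-1)].
  by move=> n; apply: GH_dist_relation => //; apply: (le_lt_trans GHc);
     rewrite lte_fin ltrDl.
have [U [UU ooU]] := ultraFilterLemma (@eventually_filter).
have UF : ProperFilter U by exact: ultra_proper.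
pose near_r x p e n := exists x' p', [/\ r n x' p', mdist x x' < e & mdist p p' < e].
exists (fun x p => forall e, 0 < e -> U (near_r x p e)); split.
- move=> x; have /choice[q qP] := fun n => let: And3 h _ _ := rP n in h x.
  have [p pP] := limN U q UU; exists p => e e0.
  by apply: filterS (pP e e0) => n pn; exists x, (q n); rewrite mdistxx.
- move=> p; have /choice[q qP] := fun n => let: And3 _ h _ := rP n in h p.
  have [x xP] := limM U q UU; exists x => e e0.
  by apply: filterS (xP e e0) => n pn; exists (q n), p; rewrite mdistxx.
- move=> x x' p p' xp xp'; apply/ler_addgt0Pr => e e0.
  have e6 : 0 < e / 6 by rewrite divr_gt0.
  have small : U [set n | n.+1%:R^-1 < e / 6 :> R].
    by apply: ooU; exact: near_infty_natSinv_lt (PosNum e6).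
  have [n [[y [q [yq xy pq]]] [[y' [q' [yq' xy' pq']]] ne]]] :=
    filter_ex (filterI (xp _ e6) (filterI (xp' _ e6) small)).
  have [_ _ /(_ y y' q q' yq yq')] := rP n.
  move: ne; rewrite /= !ler_norml; move: (n.+1%:R^-1) => i ne /andP[h1 h2].
  have := metric_triangle x y x'; have := metric_triangle y y' x'.
  have := metric_triangle y x y'; have := metric_triangle x x' y'.
  have := metric_triangle p q p'; have := metric_triangle q q' p'.
  have := metric_triangle q p q'; have := metric_triangle p p' q'.
  rewrite (metric_sym y x) (metric_sym y' x') (metric_sym q p) (metric_sym q' p') => *.
  by apply/andP; split; lra.
- move=> x p xp e e0; have [|x' [p' [xp' xx' pp']]] := xp (e / 2).
    by rewrite divr_gt0.
  have e2 : 0 < e / 2 by rewrite divr_gt0.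
  apply: filterS (xp' _ e2) => n [y [q [yq xy pq]]]; exists y, q; split => //.
    by have := metric_triangle x x' y; lra.
  by have := metric_triangle p p' q; lra.
Qed.

End compactness.

(** * Coordinates on the circle *)

Section circle_coordinates.
Context {R : realType}.
Implicit Types (p q : circle R) (s t : R).

Fact circle_point_subproof t :
  Num.sqrt ((cos t, sin t).1 ^+ 2 + (cos t, sin t).2 ^+ 2) == 1 :> R.
Proof. by rewrite /= cos2Dsin2 sqrtr1. Qed.

Definition circle_point t : circle R :=
  exist (fun z : R * R => Num.sqrt (z.1 ^+ 2 + z.2 ^+ 2) == 1) (cos t, sin t)
    (circle_point_subproof t).

Lemma circle_point_dist s t :
  mdist (circle_point s) (circle_point t) = acos (cos (s - t)).
Proof. by rewrite {1}/mdist/= /circle_dist /circle_dot/= cosB. Qed.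

Lemma circle_dist_lepi p q : mdist p q <= pi.
Proof. by rewrite /mdist/= acos_lepi// circle_dot_bound. Qed.

Lemma circle_point_distE s t : `|s - t| <= pi ->
  mdist (circle_point s) (circle_point t) = `|s - t|.
Proof.
move=> st; rewrite circle_point_dist -cos_norm cosK//.
by rewrite in_itv/= normr_ge0.
Qed.

Lemma circle_point_dist_le s t :
  mdist (circle_point s) (circle_point t) <= `|s - t|.
Proof.
have [st|st] := leP `|s - t| pi; first by rewrite circle_point_distE.
by rewrite (le_trans (circle_dist_lepi _ _))// ltW.
Qed.

Lemma circle_pointP p : exists2 t, `|t| <= pi & p = circle_point t.
Proof.
have := circle_sqr p; case: p => -[a b] /= ab1 ab.
have a1 : -1 <= a <= 1.
  by have := sqr_ge0 b; have := sqr_ge0 a => *; apply/andP; split; nra.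
have acosa : cos (acos a) = a by rewrite acosK// in_itv/=.
have sina : sin (acos a) ^+ 2 = b ^+ 2 by rewrite sin2cos2 acosa -ab addrC addKr.
have /andP[acos0 acospi] : 0 <= acos a <= pi by rewrite acos_ge0// acos_lepi.
move/eqP : sina; rewrite eqf_sqr => /orP[]/eqP sab.
  exists (acos a); first by rewrite ger0_norm.
  by apply: val_inj; rewrite /= acosa sab.
exists (- acos a); first by rewrite normrN ger0_norm.
by apply: val_inj; rewrite /= cosN sinN acosa sab opprK.
Qed.

(** Arc length coordinates, with any base point and either orientation. *)
Definition circle_param (E : R -> circle R) : Prop :=
  (forall s t, `|s - t| <= pi -> mdist (E s) (E t) = `|s - t|) /\
  forall t, E (t + pi *+ 2) = E t.

(** The distance determines the cosine of the angle from p to q, hence this angle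
    up to its sign e, which is absorbed by the orientation of E. *)
Lemma circle_paramP p q :
  exists2 E, circle_param E & p = E 0 /\ q = E (mdist p q).
Proof.
have [s _ ->] := circle_pointP p; have [t _ ->] := circle_pointP q.
rewrite circle_point_dist; set a := acos _.
have cosa : cos a = cos (t - s).
  by rewrite /a acosK ?in_itv/= ?cos_geN1 ?cos_le1// -cosN opprB.
have : sin a ^+ 2 = sin (t - s) ^+ 2 by rewrite !sin2cos2 cosa.
move/eqP; rewrite eqf_sqr => sina.
have [e [e1 sine]] : exists e : R, `|e| = 1 /\ sin (e * a) = sin (t - s).
  case/orP: sina => /eqP sina; [exists 1|exists (-1)].
    by rewrite normr1 mul1r.
  by rewrite normrN normr1 mulN1r sinN sina opprK.
have cose : cos (e * a) = cos (t - s).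
  by rewrite -cosa -[in RHS]cos_norm -[LHS]cos_norm normrM e1 mul1r.
exists (fun u => circle_point (s + e * u)).
  split=> [u v uv|u].
    by rewrite circle_point_distE opprD addrACA subrr add0r -mulrBr normrM e1 mul1r.
  have : e = 1 \/ e = -1.
    move/eqP : e1; rewrite eqr_norml ler01 andbT => /orP[]/eqP ->; by [left|right].
  case=> ->; apply: val_inj; rewrite /=.
    by rewrite !mul1r addrA cosD2pi sinD2pi.
  have -> : s + -1 * (u + pi *+ 2) = s + -1 * u - pi *+ 2 by ring.
  by rewrite -[in RHS](subrK (pi *+ 2) (s + -1 * u)) cosD2pi sinD2pi.
split; first by rewrite mulr0 addr0.
by apply: val_inj; rewrite /= !(cosD, sinD) cose sine -cosD -sinD addrC subrK.
Qed.

Lemma circle_antipode p : exists p', forall q, mdist p' q = pi - mdist p q.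
Proof.
have [s _ ->] := circle_pointP p; exists (circle_point (s + pi)) => q.
have [t _ ->] := circle_pointP q.
by rewrite !circle_point_dist addrAC cosDpi acosN// cos_geN1 cos_le1.
Qed.

Lemma circle_ultralimits : has_ultralimits (circle R).
Proof.
move=> U u UU.
have PU : ProperFilter U by exact: ultra_proper.
have /choice[t tP] : forall n, exists t, `|t| <= pi /\ u n = circle_point t.
  by move=> n; have [t ? ?] := circle_pointP (u n); exists t.
have tpi : U (t @^-1` `[- pi, pi]).
  by apply: filterS filterT => n _ /=; rewrite in_itv/= -ler_norml; have [] := tP n.
have [x [_ xU]] := @segment_compact _ (- pi) pi (t @ U) _ tpi.
exists (circle_point x) => e e0.
have tU : U [set n | `|x - t n| < e / 2].
  have [//|nU] := in_ultra_setVsetC [set n | `|x - t n| < e / 2] UU.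
  exfalso; have e2 : 0 < e / 2 by rewrite divr_gt0.
  have [y [ny yx]] := xU [set r | ~ `|x - r| < e / 2] _ nU (nbhsx_ballx x _ e2).
  by apply: ny; exact: yx.
apply: filterS tU => n /= xn; have [_ ->] := tP n.
by rewrite (le_lt_trans (circle_point_dist_le _ _))// (lt_le_trans xn)//; lra.
Qed.

End circle_coordinates.

(** * A branch point *)

Section branch_point.
Context {R : realType} {X : metricType R}.
Hypothesis rt : Rtree X.
Variable L : R.
Hypothesis lenL : (tree_length X <= L%:E)%E.
Hypothesis limX : has_ultralimits X.
Variable r : X -> circle R -> Prop.
Hypothesis r_total : forall x, exists p, r x p.
Hypothesis r_onto : forall p, exists x, r x p.
Hypothesis r_dis : forall x x' p p', r x p -> r x' p' ->
  `|mdist x x' - mdist p p'| <= pi / 2.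
Hypothesis r_closed : forall x p, (forall e, 0 < e -> exists x' p',
  [/\ r x' p', mdist x x' < e & mdist p p' < e]) -> r x p.
Implicit Types (x y z v w : X) (p q : circle R).
Local Notation d := (@mdist R X).
Local Notation dc p q := (@mdist R _ (p : circle R) (q : circle R)).

Lemma relation_le x x' p p' : r x p -> r x' p' -> d x x' <= dc p p' + pi / 2.
Proof. by move=> xp xp'; have := r_dis xp xp'; rewrite ler_norml; lra. Qed.

Lemma relation_ge x x' p p' : r x p -> r x' p' -> dc p p' - pi / 2 <= d x x'.
Proof. by move=> xp xp'; have := r_dis xp xp'; rewrite ler_norml; lra. Qed.

Lemma tree_diameter x y : d x y <= L.
Proof.
have := @disjoint_segments_length _ _ rt _ lenL 1 (fun=> x) (fun=> y).
by rewrite big_ord1; apply; case => [|//] [|//].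
Qed.

(** Otherwise each step of length e from y to g y would continue the previous
    ones, and the iterates of g would run along a geodesic ray, which is
    impossible in a bounded space. *)
Lemma backtracking (f g : X -> X) (e : R) : 0 < e -> inhabited X ->
  (forall y, d y (g y) = e /\ d (g y) (f y) = d y (f y) - e) ->
  exists y, 0 < gromov (g y) y (f (g y)).
Proof.
move=> e0 [x0] gP; apply: contrapT => /forallNP nb.
pose y n := iter n g x0.
have yP n : d (y 0%N) (y n) = n%:R * e /\ gromov (y n) (y 0%N) (f (y n)) <= 0.
  elim: n => [|n [dn gn]].
    rewrite /y/= mul0r mdistxx; split => //.
    by rewrite /gromov mdistxx; lra.
  have [gn1 gn2] := gP (y n); rewrite -[g (y n)]/(y n.+1) in gn1 gn2.
  have /negP := nb (y n); rewrite -leNgt -[g (y n)]/(y n.+1) => nbn.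
  have := gromov_hyperbolic rt (y n.+1) (y n) (y 0%N) (f (y n.+1)).
  move: gn nbn; rewrite -natr1 /gromov.
  have := metric_triangle (y 0%N) (y n) (y n.+1).
  have := metric_triangle (y 0%N) (y n.+1) (f (y n)).
  rewrite (metric_sym (y n.+1) (y n)) (metric_sym (y n) (y 0%N)).
  rewrite (metric_sym (y n.+1) (y 0%N)) ge_min => t1 t2 h1 h2.
  have dn1 : d (y 0%N) (y n.+1) = (n%:R + 1) * e by lra.
  by case/orP => h3; split => //; lra.
have yL := fun n => tree_diameter (y 0%N) (y n).
have := truncnS_gt (L / e); rewrite ltr_pdivrMr// ltNge.
by case: (yP (Num.truncn (L / e)).+1) => <- _; rewrite yL.
Qed.

(** The point z is related to the antipode of a point related to y, hence far
    from y, and a point x related to something close to this antipode is in the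
    same branch at y as z. The same holds at y' with z' and x'. If y' lies one
    short step away from y towards z, and z' is on the side of y seen from y',
    then y' separates x from x': x is beyond y', while x' is on the side of
    y. *)
Lemma turning (a : circle R -> circle R) y y' q q' z z' c c' x x' :
  (forall p q, dc (a p) q = pi - dc p q) ->
  r y q -> r y' q' -> r z (a q) -> r z' (a q') -> r x c -> r x' c' ->
  d y' z = d y z - d y y' -> 0 < gromov y' y z' ->
  d y y' <= pi / 4 - dc c (a q) -> 0 < pi / 4 - dc c' (a q') ->
  gromov y' x x' <= 0.
Proof.
move=> aP yq yq' zq zq' xc xc' yz back k k'.
have G w u p s v : r w p -> r u (a p) -> r v s ->
    pi / 4 - dc s (a p) <= gromov w u v.
  move=> wp up vs; rewrite /gromov.
  have := relation_ge wp up; have := relation_ge wp vs; have := relation_le up vs.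
  rewrite (metric_sym p (a p)) (metric_sym s (a p)) !aP mdistxx.
  lra.
have h1 := G _ _ _ _ _ yq zq xc; have h2 := G _ _ _ _ _ yq' zq' xc'.
have h3 : gromov y' y x <= 0.
  have := gromov_hyperbolic rt y y' z x; rewrite /gromov ge_min.
  move: h1; rewrite /gromov (metric_sym y' y) => h1.
  have := metric_triangle y y' x.
  by move=> t1 /orP[] t2; lra.
have h4 : 0 < gromov y' y x'.
  apply: lt_le_trans (gromov_hyperbolic rt y' y z' x').
  by rewrite lt_min back (lt_le_trans k').
rewrite leNgt; apply/negP => h5.
have := gromov_hyperbolic rt y' y x' x; rewrite leNgt => /negP; apply.
by rewrite (le_lt_trans h3)// lt_min h4 gromovC.
Qed.

(** Replace y by the point at distance e towards f y, where f y is related to the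
    antipode of a point q y related to y. By backtracking this process turns
    back, for every e > 0. As e tends to 0 the two points where it turns
    converge to the same m, and q at these points converges to qu and qv, both
    related to m. By the turning lemma m separates points u and v related to
    the antipodes of qu and qv. Then pi <= d u v, while qu and qv, being related
    to the same point, are at distance at most pi / 2; so d u v = pi and
    everything is rigid. *)
Lemma branch_point_exists : exists m u v E,
  [/\ circle_param E, r m (E (3 * pi / 4)) /\ r m (E (- (3 * pi / 4))),
      r u (E (pi / 4)) /\ r v (E (- (pi / 4))),
      d m u = pi / 2 /\ d m v = pi / 2 & d u v = pi].
Proof.
have [a aP] := choice (@circle_antipode R).
have aa p q : dc (a p) (a q) = dc p q by rewrite aP metric_sym aP metric_sym; lra.
have [q qP] := choice r_total; have [s sP] := choice r_onto.
pose f y := s (a (q y)).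
have fP y : r (f y) (a (q y)) by exact: sP.
have pi2 := @pi_ge2 R.
have df y : pi / 2 <= d y (f y).
  by have := relation_ge (qP y) (fP y); rewrite (metric_sym (q y)) aP mdistxx; lra.
have /choice[y yP] : forall n : nat, exists yy : X * X,
    [/\ d yy.1 yy.2 = n.+1%:R^-1, d yy.2 (f yy.1) = d yy.1 (f yy.1) - d yy.1 yy.2
      & 0 < gromov yy.2 yy.1 (f yy.2)].
  move=> n; have n0 : 0 < n.+1%:R^-1 :> R by [].
  have n1 : n.+1%:R^-1 <= 1 :> R by rewrite invf_le1// ler1n.
  have /choice[g gP] : forall y, exists v, d y v = n.+1%:R^-1 /\
      d v (f y) = d y (f y) - n.+1%:R^-1.
    move=> y; apply: geodesic_point => //; rewrite ltW//=.
    by rewrite (le_trans _ (df y))// (le_trans n1)//; lra.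
  have [|y by0] := backtracking n0 _ gP; first by case: rt => -[x _] _.
  by exists (y, g y); have [gy1 gy2] := gP y; rewrite /= gy1 gy2.
have [U [UU ooU]] := ultraFilterLemma (@eventually_filter).
have PU : ProperFilter U by exact: ultra_proper.
have [m mP] := limX (fun n => (y n).1) UU.
have [qu quP] := @circle_ultralimits R _ (fun n => q (y n).1) UU.
have [qv qvP] := @circle_ultralimits R _ (fun n => q (y n).2) UU.
have near0 e : 0 < e -> U [set n | d (y n).1 (y n).2 < e].
  move=> e0; have := ooU _ (near_infty_natSinv_lt (PosNum e0)).
  by apply: filterS => n /= ne; have [-> _ _] := yP n.
have mP2 e : 0 < e -> U [set n | d m (y n).2 < e].
  move=> e0; have e2 : 0 < e / 2 by rewrite divr_gt0.
  apply: filterS2 (mP _ e2) (near0 _ e2) => n /= h1 h2.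
  by have := metric_triangle m (y n).1 (y n).2; lra.
have mqu : r m qu.
  apply: r_closed => e e0.
  have [n [h1 h2]] := filter_ex (filterI (mP _ e0) (quP _ e0)).
  by exists (y n).1, (q (y n).1).
have mqv : r m qv.
  apply: r_closed => e e0.
  have [n [h1 h2]] := filter_ex (filterI (mP2 _ e0) (qvP _ e0)).
  by exists (y n).2, (q (y n).2).
pose u := s (a qu); pose v := s (a qv).
have ru : r u (a qu) by exact: sP.
have rv : r v (a qv) by exact: sP.
have muv : d u m + d m v <= d u v.
  apply/ler_addgt0Pr => e e0.
  have e2 : 0 < Num.min (e / 2) (pi / 16) by rewrite lt_min !divr_gt0//; lra.
  have [n [[h1 h2] [h3 h4]]] := filter_ex (filterI
    (filterI (near0 _ e2) (mP2 _ e2)) (filterI (quP _ e2) (qvP _ e2))).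
  have [_ y2 y3] := yP n.
  rewrite /= !lt_min in h1 h2 h3 h4.
  have := @turning a _ _ _ _ _ _ _ _ u v aP (qP (y n).1) (qP (y n).2)
    (fP (y n).1) (fP (y n).2) ru rv y2 y3.
  rewrite !aa => /(_ _ _)H.
  have : gromov (y n).2 u v <= 0 by apply: H; lra.
  rewrite /gromov.
  have := metric_triangle u (y n).2 m; have := metric_triangle m (y n).2 v.
  rewrite (metric_sym (y n).2 m) (metric_sym u (y n).2).
  by move: h2 => /andP[h21 h22] t1 t2 t3; lra.
have mu : pi / 2 <= d m u.
  by have := relation_ge mqu ru; rewrite (metric_sym qu) aP mdistxx; lra.
have mv : pi / 2 <= d m v.
  by have := relation_ge mqv rv; rewrite (metric_sym qv) aP mdistxx; lra.
have quv : dc qu qv <= pi / 2.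
  by have := relation_ge mqu mqv; rewrite mdistxx; lra.
have uv := relation_le ru rv; rewrite aa in uv.
rewrite (metric_sym u m) in muv.
have [E [Ed Ep] [E0 E1]] := circle_paramP (a qu) (a qv).
have aquv : dc (a qu) (a qv) = pi / 2 by rewrite aa; lra.
rewrite aquv in E1.
exists m, u, v, (fun t => E (pi / 4 - t)).
have quE : qu = E pi.
  apply: mdist_positivity; have := aP qu (E pi); rewrite E0 Ed; last first.
    by rewrite sub0r normrN ger0_norm; lra.
  by rewrite sub0r normrN ger0_norm; lra.
have qvE : qv = E (- (pi / 2)).
  apply: mdist_positivity; have := aP qv (E (- (pi / 2))); rewrite E1 Ed.
    by rewrite opprK ger0_norm; lra.
  by rewrite opprK ger0_norm; lra.
split.
- split => [s1 t1 st|t]; last first.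
    rewrite -Ep; congr E; ring.
  have -> : `|s1 - t1| = `|(pi / 4 - s1) - (pi / 4 - t1)|.
    by rewrite distrC; congr `|_|; ring.
  by rewrite Ed//; move: st; rewrite distrC; congr (`|_| <= _); ring.
- rewrite (_ : pi / 4 - 3 * pi / 4 = - (pi / 2)); last by field.
  rewrite (_ : pi / 4 - - (3 * pi / 4) = pi); last by field.
  by rewrite -quE -qvE.
- rewrite subrr -E0 opprK (_ : pi / 4 + pi / 4 = pi / 2); last by field.
  by rewrite -E1.
- by split; lra.
- by lra.
Qed.

End branch_point.

(** * Rigidity of the optimal correspondence *)

Section rigidity.
Context {R : realType} {X : metricType R}.
Hypothesis rt : Rtree X.
Hypothesis lenX : (tree_length X <= (5 * pi / 4)%:E)%E.
Hypothesis limX : has_ultralimits X.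
Variable r : X -> circle R -> Prop.
Hypothesis r_onto : forall p, exists x, r x p.
Hypothesis r_dis : forall x x' p p', r x p -> r x' p' ->
  `|mdist x x' - mdist p p'| <= pi / 2.
Hypothesis r_closed : forall x p, (forall e, 0 < e -> exists x' p',
  [/\ r x' p', mdist x x' < e & mdist p p' < e]) -> r x p.
Implicit Types (x y z w : X) (E : R -> circle R).
Local Notation d := (@mdist R X).

Lemma param_dist E s t : circle_param E -> s <= t <= s + pi ->
  mdist (E s) (E t) = t - s.
Proof.
move=> [Ed _] /andP[st tpi]; rewrite Ed distrC ger0_norm ?subr_ge0//.
by rewrite lerBlDl.
Qed.

Lemma param_le E s t x x' : circle_param E -> r x (E s) -> r x' (E t) ->
  s <= t <= s + pi -> d x x' <= t - s + pi / 2.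
Proof.
by move=> Ep xs xt st; rewrite -(param_dist Ep st); exact: (relation_le r_dis).
Qed.

Lemma param_ge E s t x x' : circle_param E -> r x (E s) -> r x' (E t) ->
  s <= t <= s + pi -> t - s - pi / 2 <= d x x'.
Proof.
by move=> Ep xs xt st; rewrite -(param_dist Ep st); exact: (relation_ge r_dis).
Qed.

(** The limit point x reached along the circle from the side of positive t; the
    points z near x are kept since they satisfy sharper inequalities. *)
Lemma param_limit E s : circle_param E -> exists x, r x (E s) /\
  forall e, 0 < e -> exists z t, [/\ r z (E (s + t)), 0 < t, t < e & d x z < e].
Proof.
have pi0 := @pi_gt0 R.
move=> [Ed _].
have /choice[x xP] := fun n : nat => r_onto (E (s + n.+1%:R^-1)).
have [U [UU ooU]] := ultraFilterLemma (@eventually_filter).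
have PU : ProperFilter U by exact: ultra_proper.
have [y yP] := limX x UU.
have H e : 0 < e -> exists z t, [/\ r z (E (s + t)), 0 < t, t < e & d y z < e].
  move=> e0.
  have [n [/= h1 h2]] := filter_ex (filterI (yP _ e0)
    (ooU _ (near_infty_natSinv_lt (PosNum e0)))).
  by exists (x n), n.+1%:R^-1.
exists y; split => //; apply: r_closed => e e0.
have e2 : 0 < Num.min e pi by rewrite lt_min e0.
have [z [t [zt t0 te yz]]] := H _ e2; exists z, (E (s + t)).
move: te yz; rewrite !lt_min => /andP[te tpi] /andP[yz _]; split => //.
by rewrite Ed opprD addrA subrr add0r normrN gtr0_norm// ltW.
Qed.

Lemma param_opp E : circle_param E -> circle_param (fun t => E (- t)).
Proof.
move=> [Ed Ep]; split => [s t st|t]; last by rewrite -Ep; congr E; ring.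
have e : `|- s - - t| = `|s - t| by rewrite distrC opprK addrC.
by rewrite Ed e.
Qed.

(** The point m is related to the angles 3 * pi / 4 and - 3 * pi / 4, so that a
    point z related to a small angle t > 0 is at distance at least pi / 4 + t
    from m and in the branch of u; y is a limit of such points as t tends to
    0. *)
Lemma side_point E m u : circle_param E ->
  r m (E (3 * pi / 4)) -> r m (E (- (3 * pi / 4))) -> r u (E (pi / 4)) ->
  d m u = pi / 2 ->
  exists y, [/\ r y (E 0), pi / 4 <= d m y & 0 < gromov m y u].
Proof.
have pi0 := @pi_gt0 R.
move=> Ep m1 m2 u1 mu; have [y [y0 yP]] := param_limit 0 Ep.
have my : pi / 4 <= d m y.
  have : 3 * pi / 4 - 0 - pi / 2 <= d y m.
    by apply: (param_ge Ep y0 m1); apply/andP; split; lra.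
  by rewrite metric_sym; lra.
exists y; split => //.
have [|z [t [zt t0 te yz]]] := yP (pi / 4); first lra.
rewrite add0r in zt.
have h1 : pi / 4 + t <= d m z.
  have : t - - (3 * pi / 4) - pi / 2 <= d m z.
    by apply: (param_ge Ep m2 zt); apply/andP; split; lra.
  lra.
have h2 : d z u <= 3 * pi / 4 - t.
  have : d z u <= pi / 4 - t + pi / 2.
    by apply: (param_le Ep zt u1); apply/andP; split; lra.
  lra.
apply: lt_le_trans (gromov_hyperbolic rt m y z u).
rewrite lt_min /gromov; apply/andP; split; lra.
Qed.

(** The rigid part of a correspondence with the circle. The points y and y' come
    as the two limits, from either side, of the points related to small angles; the
    circle is torn at the angle 0, and m is the midpoint of the gap. *)
Record configuration E m u v y y' : Prop := Configuration {
  conf_param : circle_param E;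
  conf_u : r u (E (pi / 4));
  conf_v : r v (E (- (pi / 4)));
  conf_y : r y (E 0);
  conf_y' : r y' (E 0);
  conf_mu : d m u = pi / 2;
  conf_mv : d m v = pi / 2;
  conf_uv : d u v = pi;
  conf_my : d m y = pi / 4;
  conf_my' : d m y' = pi / 4;
  conf_yu : 0 < gromov m y u;
  conf_yv : 0 < gromov m y' v }.

Lemma configuration_exists (r_total : forall x, exists p, r x p) :
  exists E m u v y y', configuration E m u v y y'.
Proof.
have pi0 := @pi_gt0 R.
have [m [u [v [E [Ep [m1 m2] [u1 v1] [mu mv] uv]]]]] :=
  branch_point_exists rt lenX limX r_total r_onto r_dis r_closed.
have [y [y0 my yu]] := side_point Ep m1 m2 u1 mu.
have [y' [y'0 my' yv]] : exists y', [/\ r y' (E 0), pi / 4 <= d m y' & 0 < gromov m y' v].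
  have := @side_point _ m v (param_opp Ep); rewrite opprK oppr0; exact.
have yy' : d m y + d m y' <= d y y'.
  rewrite leNgt; apply/negP => lt.
  have h1 : 0 < gromov m y y' by rewrite /gromov; lra.
  have h2 : 0 < gromov m y v.
    by apply: lt_le_trans (gromov_hyperbolic rt m y y' v); rewrite lt_min h1.
  have h3 : 0 < gromov m u v.
    apply: lt_le_trans (gromov_hyperbolic rt m u y v).
    by rewrite lt_min h2 gromovC yu.
  by move: h3; rewrite /gromov; lra.
have h : d y y' <= 0 - 0 + pi / 2.
  by apply: (param_le Ep y0 y'0); apply/andP; split; lra.
by exists E, m, u, v, y, y'; split => //; lra.
Qed.

Lemma configuration_opp E m u v y y' : configuration E m u v y y' ->
  configuration (fun t => E (- t)) m v u y' y.
Proof.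
case=> Ep u1 v1 y0 y'0 mu mv uv my my' yu yv; split => //.
- exact: param_opp.
- by rewrite opprK.
- by rewrite oppr0.
- by rewrite oppr0.
- by rewrite metric_sym.
Qed.

Lemma conf_dyv E m u v y y' : configuration E m u v y y' -> d y v = 3 * pi / 4.
Proof.
have pi0 := @pi_gt0 R.
case=> _ _ _ _ _ mu mv uv my _ yu _.
have := metric_triangle y m v; rewrite (metric_sym y m) my mv => h.
apply/eqP; rewrite eq_le; apply/andP; split; first lra.
rewrite leNgt; apply/negP => lt.
have h2 : 0 < gromov m y v by rewrite /gromov; lra.
have h3 : 0 < gromov m u v.
  apply: lt_le_trans (gromov_hyperbolic rt m u y v).
  by rewrite lt_min h2 gromovC yu.
by move: h3; rewrite /gromov; lra.
Qed.

Lemma antipodal_dist E m u v y y' c : configuration E m u v y y' ->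
  r c (E pi) -> [/\ pi / 2 <= d c y, pi / 2 <= d c y', pi / 4 <= d c m &
    pi / 4 <= d c u].
Proof.
have pi0 := @pi_gt0 R.
move=> C c1; have := conf_param C => Ep.
have o : 0 <= (pi : R) <= 0 + pi by apply/andP; split; lra.
have cy : pi / 2 <= d c y.
  by have := param_ge Ep (conf_y C) c1 o; rewrite metric_sym; lra.
split => //.
- by have := param_ge Ep (conf_y' C) c1 o; rewrite metric_sym; lra.
- by have := metric_triangle c m y; rewrite (conf_my C); lra.
- have : pi - pi / 4 - pi / 2 <= d u c.
    by apply: (param_ge Ep (conf_u C) c1); apply/andP; split; lra.
  by rewrite metric_sym; lra.
Qed.

(** If a point c related to the angle pi were in the branch of u at m, the subtree
    spanned by v, u, y and c would already have length at least 5 * pi / 4, with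
    equality only in a one-parameter family of shapes. The four-point condition
    on u, v, y, c excludes all but these. *)
Lemma antipodal_side E m u v y y' c : configuration E m u v y y' ->
  r c (E pi) -> 0 < gromov m c u ->
  [/\ d c u = pi / 4, pi / 4 < d c m, d c v = d c m + pi / 2 & 
   d y u + d c m = pi].
Proof.
have pi0 := @pi_gt0 R.
move=> C c1 cu; have [cy cy' cm cu'] := antipodal_dist C c1.
have yv := conf_dyv C.
have [_ _ _ _ _ mu mv uv my _ yu _] := C.
have cv : d c v = d c m + pi / 2.
  have := metric_triangle c m v; rewrite mv => h.
  apply/eqP; rewrite eq_le; apply/andP; split; first lra.
  rewrite leNgt; apply/negP => lt.
  have h2 : 0 < gromov m c v by rewrite /gromov (metric_sym m c); lra.
  have h3 : 0 < gromov m u v.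
    apply: lt_le_trans (gromov_hyperbolic rt m u c v).
    by rewrite lt_min h2 gromovC cu.
  by move: h3; rewrite /gromov; lra.
have cy2 : 0 < gromov m c y.
  apply: lt_le_trans (gromov_hyperbolic rt m c u y).
  by rewrite lt_min cu gromovC yu.
pose x := nth v [:: u; y; c].
pose delta := nth 0 [:: pi; gromov y u v; Num.min (gromov c u v) (gromov c y v)].
have := @greedy_length _ _ rt _ lenX 3 v x delta.
rewrite !big_ord_recl big_ord0 /delta/= addr0.
have dyu := metric_triangle u y m.
have dyu' := metric_triangle m y u.
have fp := four_point rt u v y c.
rewrite /gromov in cu yu cy2.
rewrite (metric_sym m c) in cu cy2.
rewrite (metric_sym y m) in dyu.
rewrite (metric_sym u y) (metric_sym u c) (metric_sym v c) (metric_sym v y) (metric_sym y c) in fp.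
rewrite le_max in fp.
have H : pi + (gromov y u v + Num.min (gromov c u v) (gromov c y v)) <= 5 * pi / 4 ->
  [/\ d c u = pi / 4, pi / 4 < d c m, d c v = d c m + pi / 2 & d y u + d c m = pi].
  rewrite minEle /gromov; case: ifP => _ len; case/orP: fp => fp; split; lra.
move=> h; apply: H; apply: h.
case=> [|[|[|//]]] _ /=.
- by rewrite uv; split.
- split; first by rewrite gromovC gromov_le.
  by case.
- split; first by rewrite ge_min gromovC gromov_le.
  by case=> [|[|//]] _ /=; rewrite ge_min lexx ?orbT.
Qed.

(** The exceptional shapes are excluded by continuity. Let c be the limit of points
    x related to angles slightly larger than pi. Since the subtree spanned by v,
    u, y and c has the maximal length, x belongs to it and, being close to the
    leaf c, lies between c and v. Hence x is at most as far from u as c, that is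
    pi / 4, whereas its angle forces a larger distance. *)
Lemma antipodal_not_side E m u v y y' c : configuration E m u v y y' ->
  r c (E pi) -> gromov m c u <= 0.
Proof.
have pi0 := @pi_gt0 R.
move=> C c1; rewrite leNgt; apply/negP => cu.
have [_ cm _ _] := antipodal_side C c1 cu.
have Ep := conf_param C.
have [c' [c1' limc']] := param_limit pi Ep.
have [cy cy' cm' _] := antipodal_dist C c1'.
(* c' is in the same branch as c, which is further than pi / 4 from m *)
have cu' : 0 < gromov m c' u.
  have cc' : d c c' <= pi / 2.
    have : d c c' <= pi - pi + pi / 2.
      by apply: (param_le Ep c1 c1'); apply/andP; split; lra.
    lra.
  apply: lt_le_trans (gromov_hyperbolic rt m c' c u); rewrite lt_min cu andbT.
  by rewrite /gromov (metric_sym m c) (metric_sym m c') (metric_sym c' c); lra.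
move: c {c1} c' cu' c1' limc' cy cy' cm' {cu cm} => _ c cu c1 limc cy cy' cm'.
have [cdu cm cv yucm] := antipodal_side C c1 cu.
have [|x [t [x1 t0 te cx]]] := limc (Num.min (pi / 4) ((d c m - pi / 4) / 4)).
  by rewrite lt_min !divr_gt0// subr_gt0.
rewrite !lt_min in te cx; case/andP: te => te _; case/andP: cx => cx cx'.
have xu : pi / 4 + t <= d x u.
  have : pi + t - pi / 4 - pi / 2 <= d u x.
    by apply: (param_ge Ep (conf_u C) x1); apply/andP; split; lra.
  by rewrite metric_sym; lra.
have yv := conf_dyv C.
have [_ _ _ _ _ mu mv uv my _ yu _] := C.
pose a := nth v [:: u; y; c; x].
pose e := Num.min (gromov x u v) (Num.min (gromov x y v) (gromov x c v)).
pose delta := nth 0 [:: pi; gromov y u v; gromov c u v; e].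
have := @greedy_length _ _ rt _ lenX 4 v a delta.
rewrite !big_ord_recl big_ord0 /delta/= addr0.
have dcu : gromov c u v <= gromov c y v by rewrite /gromov; lra.
have fp := four_point rt x u c v.
rewrite le_max (metric_sym x c) (metric_sym u c) in fp.
have x_v := metric_triangle c x v.
have y_x := metric_triangle c x y.
have u_x := metric_triangle c x u.
have cx0 := mdist_ge0 c x.
have H : pi + (gromov y u v + (gromov c u v + e)) <= 5 * pi / 4 -> False.
  have : e = gromov x u v \/ e = gromov x y v \/ e = gromov x c v.
    by rewrite /e; case: leP => _; [left|right; case: leP => _; [left|right]].
  rewrite /gromov (metric_sym x c).
  by case=> [|[|]] -> len; case/orP: fp => fp; lra.
move=> h; apply: H; apply: h.
case=> [|[|[|[|//]]]] _ /=.
- by rewrite uv; split.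
- split; first by rewrite gromovC gromov_le.
  by case.
- split; first by rewrite gromovC gromov_le.
  by case=> [|[|//]] _ /=.
- split; first by rewrite /e ge_min gromovC gromov_le.
  by case=> [|[|[|//]]] _ /=; rewrite /e !ge_min lexx ?orbT.
Qed.

(** The points related to the angle pi are in neither of the branches of u and v
    at m, so that one of them, c, starts a third leg, of length at least pi / 4.
    The length bound makes this an equality and leaves no room for a point x
    outside the three legs. *)
Lemma tripod_exists (r_total : forall x, exists p, r x p) :
  exists m u v c, [/\ [/\ d m u = pi / 2, d m v = pi / 2 & d m c = pi / 4],
    [/\ d u v = pi, d c u = 3 * pi / 4 & d c v = 3 * pi / 4] &
    forall x, gromov x u v <= 0 \/ gromov x c v <= 0].
Proof.
have pi0 := @pi_gt0 R.
have [E [m [u [v [y [y' C]]]]]] := configuration_exists r_total.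
have [c c1] := r_onto (E pi).
have [cy cy' cm _] := antipodal_dist C c1.
have cu := antipodal_not_side C c1.
have cv : gromov m c v <= 0.
  apply: (antipodal_not_side (configuration_opp C)).
  by rewrite -(proj2 (conf_param C)) mulr2n addrA addNr add0r.
have [_ _ _ _ _ mu mv uv _ _ _ _] := C.
have cu' := metric_triangle c m u; have cv' := metric_triangle c m v.
rewrite /gromov (metric_sym m c) in cu cv.
have {}cu : d c u = d c m + pi / 2 by apply/eqP; rewrite eq_le; apply/andP; split; lra.
have {}cv : d c v = d c m + pi / 2 by apply/eqP; rewrite eq_le; apply/andP; split; lra.
have L x : d c m + Num.min (gromov x u v) (gromov x c v) <= pi / 4.
  pose a := nth v [:: u; c; x].
  pose e := Num.min (gromov x u v) (gromov x c v).
  pose delta := nth 0 [:: pi; d c m; e].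
  have := @greedy_length _ _ rt _ lenX 3 v a delta.
  rewrite !big_ord_recl big_ord0 /delta/= addr0 -/e.
  have H : pi + (d c m + e) <= 5 * pi / 4 -> d c m + e <= pi / 4 by lra.
  move=> h; apply: H; apply: h.
  case=> [|[|[|//]]] _ /=.
  - by rewrite uv; split.
  - split; first lra.
    by case => [|//] _ /=; rewrite /gromov; lra.
  - split; first by rewrite /e ge_min gromovC gromov_le.
    by case=> [|[|//]] _ /=; rewrite /e !ge_min lexx ?orbT.
have cm4 : d c m = pi / 4.
  have := L c; rewrite minEle; case: ifP => _; rewrite /gromov ?mdistxx; lra.
exists m, u, v, c; split; [by rewrite (metric_sym m c)|by split=> //; lra|].
move=> x; have := L x; rewrite minEle; case: ifP => _ h; [left|right]; lra.
Qed.

End rigidity.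

(** * The tripod *)

Section tripod.
Context {R : realType} {X : metricType R}.
Hypothesis rt : Rtree X.
Local Notation d := (@mdist R X).

Lemma between_split m a b x : d a b = d m a + d m b -> gromov x a b <= 0 ->
  d m x + d x a = d m a \/ d m x + d x b = d m b.
Proof.
rewrite /gromov => ab xab.
have := four_point rt m x a b; rewrite le_max.
have ma := metric_triangle m x a; have mb := metric_triangle m x b.
have xm := metric_triangle a x b; rewrite (metric_sym a x) in xm.
by case/orP => h; [left|right]; lra.
Qed.

(** A tree that is the union of three segments from m, pairwise opposite at m, is
    isometric to the model: a point goes to its leg and its distance to m. *)
Lemma tripod_isometric m (e : 'I_3 -> X) :
  (forall i, d m (e i) = E_leg R i) ->
  (forall i j, i != j -> d (e i) (e j) = d m (e i) + d m (e j)) ->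
  (forall x, exists i, d m x + d x (e i) = d m (e i)) ->
  isometric [set: X] [set: treeE R].
Proof.
move=> de dee leg.
have dist_same i x y : d m x + d x (e i) = d m (e i) ->
    d m y + d y (e i) = d m (e i) -> d x y = `|d m x - d m y|.
  move=> xi yi; apply/eqP; rewrite eq_le; apply/andP; split.
    have := four_point rt x y m (e i); rewrite le_max.
    rewrite (metric_sym x m) (metric_sym y m) => /orP[] h.
      by rewrite (le_trans _ (ler_norm _))//; lra.
    by rewrite distrC (le_trans _ (ler_norm _))//; lra.
  have := metric_triangle m x y; have := metric_triangle m y x.
  by rewrite (metric_sym y x) ler_norml => h1 h2; apply/andP; split; lra.
have dist_diff i j x y : i != j -> d m x + d x (e i) = d m (e i) ->
    d m y + d y (e j) = d m (e j) -> d x y = d m x + d m y.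
  move=> /dee ij xi yj; apply/eqP; rewrite eq_le; apply/andP; split.
    by have := metric_triangle x m y; rewrite (metric_sym x m).
  have := metric_triangle (e i) x (e j); have := metric_triangle x y (e j).
  by rewrite (metric_sym (e i) x); lra.
have /choice[l lP] : forall x, exists i, d m x + d x (e i) = d m (e i) /\
    (d m x == 0) ==> (i == ord0).
  move=> x; have [xm|xm] := eqVneq (d m x) 0; last by have [i] := leg x; exists i.
  by exists ord0; rewrite -(mdist_positivity _ _ xm) mdistxx add0r.
have fE x : E_pred (l x, d m x).
  have [lx l0] := lP x; rewrite /E_pred/= l0 andbT mdist_ge0/= -de -lx.
  by rewrite lerDl mdist_ge0.
pose f x : treeE R := exist (@E_pred R) (l x, d m x) (fE x).
exists f.
  move=> x y _ _; rewrite {1}/mdist/= /treeE_dist/=.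
  have [lx _] := lP x; have [ly _] := lP y.
  case: eqVneq => [lxy|lxy]; last by rewrite (dist_diff _ _ _ _ lxy lx ly).
  by rewrite (dist_same _ _ _ lx) // lxy.
apply/seteqP; split => // -[[i t] it] _.
have := it; rewrite /E_pred/= => /andP[ti t0].
have [x [xt xi]] : exists x, d m x = t /\ d x (e i) = d m (e i) - t.
  by apply: geodesic_point; rewrite ?de.
exists x => //; apply: val_inj => /=; rewrite xt; congr (_, _).
have [lx l0] := lP x.
have [t00|tn0] := eqVneq t 0.
  by move: l0 t0; rewrite xt t00 eqxx /= => /eqP -> /eqP ->.
apply/eqP; apply: contraT => li; move: tn0.
have xi' : d m x + d x (e i) = d m (e i) by lra.
have := dist_diff _ _ _ _ li lx xi'; rewrite mdistxx xt => h.
by rewrite (_ : t = 0) ?eqxx//; lra.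
Qed.

End tripod.

Theorem proposition4p5 (R : realType) (X : metricType R) :
  complete_space X -> Rtree X ->
  (tree_length X <= (5 * pi / 4)%:E)%E ->
  GH_dist X (circle R) = (pi / 4)%:E ->
  isometric [set: X] [set: treeE R].
Proof.
move=> cX rt lenX GHX.
have limX := totally_bounded_ultralimits cX (Rtree_totally_bounded rt lenX).
have GHle : (GH_dist X (circle R) <= (pi / 4)%:E)%E by rewrite GHX.
have [r [r_total r_onto r_dis r_closed]] :=
  GH_dist_closed_relation limX circle_ultralimits GHle.
have {}r_dis x x' p p' : r x p -> r x' p' -> `|mdist x x' - mdist p p'| <= pi / 2.
  by move=> xp xp'; have := r_dis _ _ _ _ xp xp'; rewrite (_ : 2 * (pi / 4) = pi / 2)//; field.
have [m [u [v [c [[mu mv mc] [uv cu cv] hull]]]]] :=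
  tripod_exists rt lenX limX r_onto r_dis r_closed r_total.
have pi0 := @pi_gt0 R.
apply: (@tripod_isometric _ _ rt m (tnth [tuple u; v; c])).
- by case=> -[|[|[|//]]] i3; rewrite /E_leg !(tnth_nth 0, tnth_nth m) /=.
- case=> -[|[|[|//]]] i3; case=> -[|[|[|//]]] j3 // _;
    rewrite !(tnth_nth m) /= ?(metric_sym v u) ?(metric_sym u c) ?(metric_sym v c); lra.
- move=> x.
  pose i0 := @Ordinal 3 0 isT; pose i1 := @Ordinal 3 1 isT.
  pose i2 := @Ordinal 3 2 isT.
  case: (hull x) => /between_split - /(_ rt m)[|xu|xv].
  - lra.
  - by exists i0; rewrite (tnth_nth m).
  - by exists i1; rewrite (tnth_nth m).
  - by rewrite cv; lra.
  - by exists i2; rewrite (tnth_nth m).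
  - by exists i1; rewrite (tnth_nth m).
Qed.
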